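(* Assume there exists $\gamma>0$ such that the propensities satisfy $p^{\sigma_{q,g}^f(j)}>\gamma$ for all $g\in\mathcal G$, all queries $q\in\mathcal Q$ (and all relevance vectors), and all $j\in\{1,\dots,t_g^{\max}\}$. Let $m>1$ be the number of logged requests. Then for any $\lambda>0$, $g\in\mathcal G$, $t\in\{1,\dots,t_g^{\max}-1\}$ and $\alpha\in(0,1)$, with probability at least $1-\alpha$, $$U_g(t)\ \le\ \hat U_{g,\lambda}^{\mathrm{CIPW}}(t)+\sqrt{\frac{2V_m(\mathbf Z^{g,t})\ln(4/\alpha)}{m}}+\frac{7t\lambda\ln(4/\alpha)}{3(m-1)}+t\sqrt{\frac{\ln(2/\alpha)}{2m}}+\frac1m\sum_{i=1}^m\sum_{j=1}^t\max\Big(0,1-\lambda p_i^{\sigma_{Q_i,g}^f(j)}\Big),$$ where $\mathbf Z^{g,t}=(Z_i^{g,t})_{i=1}^m$ with $$Z_i^{g,t}=\sum_{j=1}^t\min\Big(\lambda,\frac1{p_i^{\sigma_{Q_i,g}^f(j)}}\Big)C_i^{\sigma_{Q_i,g}^f(j)},\qquad \hat U_{g,\lambda}^{\mathrm{CIPW}}(t)=\frac1m\sum_{i=1}^m Z_i^{g,t},$$ $$V_m(\mathbf Z^{g,t})=\frac1{m(m-1)}\sum_{1\le i<j\le m}\big(Z_i^{g,t}-Z_j^{g,t}\big)^2 .$$ (The right-hand side of the inequality is denoted $\hat U_g^+(t,\alpha)$.)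
   Context: There are $n$ items $d^1,\dots,d^n$ in an item space $\mathcal D$, and a family $\mathcal G$ of (possibly overlapping) groups of items. A recommendation request is a pair $(q,\mathbf r)$ drawn from a distribution $P_{Q,\mathbf R}$, where $q\in\mathcal Q$ is a query and $\mathbf r=(r^1,\dots,r^n)\in\{0,1\}^n$ is the vector of relevances of the items. A relevance model $f:\mathcal Q\times\mathcal D\to[0,1]$ is fixed. For a query $q$ and group $g$, $\sigma_{q,g}^f$ is a deterministic ranking of the items of $g$ by decreasing value of $f(q,\cdot)$; $\sigma_{q,g}^f(j)$ is the index of the item of $g$ ranked at position $j$. For each $g$, $t_g^{\max}$ is a positive integer (at most the number of items in $g$). For $t\in\{0,1,\dots,t_g^{\max}\}$, $$U_g(t):=\mathbb E_{(q,\mathbf r)\sim P_{Q,\mathbf R}}\Big[\sum_{j=1}^{t} r^{\sigma_{q,g}^f(j)}\Big].$$ Logged data: for a fixed logging policy $\pi_0$, for each $i\in\{1,\dots,m\}$, independently, $(Q_i,\mathbf R_i)\sim P_{Q,\mathbf R}$, and a user observation vector $\mathbf O_i=(O_i^1,\dots,O_i^n)\in\{0,1\}^n$ is drawn from a conditional distribution $P^{\pi_0}_{\mathbf O\mid Q,\mathbf R}$ given $(Q_i,\mathbf R_i)$ (the same for all $i$). The user feedback on item $j$ is $C_i^j=O_i^jR_i^j$. The propensity is $p_i^j:=\Pr(O_i^j=1\mid Q_i,\mathbf R_i;\pi_0)$, a function of $(Q_i,\mathbf R_i)$ which is assumed known. In the positivity assumption, $p^{j}$ denotes the propensity of item $j$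 for a generic request. *)

(* Defs.v *)
From mathcomp Require Import all_boot all_order all_algebra.
From mathcomp Require Import all_classical all_reals all_analysis.

Set Implicit Arguments.
Unset Strict Implicit.
Unset Printing Implicit Defensive.

Import Order.TTheory GRing.Theory Num.Theory.
Local Open Scope classical_set_scope.
Local Open Scope ring_scope.

(* A relevance (or observation) vector of {0,1}^n is an [n.-tuple bool], with
   its library sigma-algebra generated by the coordinates.  A recommendation
   request (q, r) is an element of [Q * n.-tuple bool]. *)

(* Positions are numbered from 1: [s j] is the index of the item ranked at
   position [j], and is meaningful only for 1 <= j <= #|g|.  Ties between equal
   scores may be broken arbitrarily. *)
Definition is_ranking (R : realType) (n : nat) (score : 'I_n -> R)
    (g : {set 'I_n}) (s : nat -> 'I_n) : Prop :=
  let ranked := [seq s j | j <- iota 1 #|g|] in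
  perm_eq ranked (enum g) /\ sorted (fun a b => score b <= score a) ranked.

Definition utility (R : realType) (d : measure_display) (Q : measurableType d)
    (n : nat) (PQR : probability (Q * n.-tuple bool)%type R)
    (sigma : Q -> {set 'I_n} -> nat -> 'I_n) (g : {set 'I_n}) (t : nat)
    : \bar R :=
  ('E_PQR [fun x => (\sum_(1 <= j < t.+1) (tnth x.2 (sigma x.1 g j))%:R)%R])%E.

Definition propensity (R : realType) (d : measure_display)
    (Q : measurableType d) (n : nat)
    (PO : R.-pker (Q * n.-tuple bool)%type ~> (n.-tuple bool))
    (x : Q * n.-tuple bool) (i : 'I_n) : R :=
  fine (PO x [set o : n.-tuple bool | tnth o i = true]).

Definition mutually_independent (R : realType) (d d' : measure_display)
    (Omega : measurableType d) (T : measurableType d')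
    (P : probability Omega R) (I : finType) (X : I -> Omega -> T) : Prop :=
  forall (J : {set I}) (B : I -> set T),
    (forall i, i \in J -> measurable (B i)) ->
    P [set w | forall i, i \in J -> B i (X i w)] =
    (\prod_(i in J) P (X i @^-1` B i))%E.

(* The i-th log entry is ((Q_i, R_i), O_i): entries are independent,
   (Q_i, R_i) has law [PQR] and [PO] is the conditional law of O_i given
   (Q_i, R_i). *)
Definition logged_data (R : realType) (d dO : measure_display)
    (Q : measurableType d) (n m : nat) (Omega : measurableType dO)
    (P : probability Omega R)
    (PQR : probability (Q * n.-tuple bool)%type R)
    (PO : R.-pker (Q * n.-tuple bool)%type ~> (n.-tuple bool))
    (W : 'I_m -> Omega -> (Q * n.-tuple bool) * n.-tuple bool) : Prop :=
  [/\ forall i, measurable_fun setT (W i),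
      mutually_independent P W,
      forall i (A : set (Q * n.-tuple bool)), measurable A ->
        P [set w | A (W i w).1] = PQR A &
      forall i (A : set (Q * n.-tuple bool)) (B : set (n.-tuple bool)),
        measurable A -> measurable B ->
        P [set w | A (W i w).1 /\ B (W i w).2] =
        (\int[PQR]_(x in A) PO x B)%E].

Definition feedback (R : realType) (n : nat) (o r : n.-tuple bool) (i : 'I_n)
    : R := (tnth o i)%:R * (tnth r i)%:R.

(* Z_i^{g,t} as a function of the i-th log entry [y]. *)
Definition clipped_reward (R : realType) (d : measure_display)
    (Q : measurableType d) (n : nat)
    (PO : R.-pker (Q * n.-tuple bool)%type ~> (n.-tuple bool))
    (sigma : Q -> {set 'I_n} -> nat -> 'I_n) (lambda : R) (g : {set 'I_n})
    (t : nat) (y : (Q * n.-tuple bool) * n.-tuple bool) : R :=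
  \sum_(1 <= j < t.+1)
    Num.min lambda (1 / propensity PO y.1 (sigma y.1.1 g j)) *
    feedback R y.2 y.1.2 (sigma y.1.1 g j).

Definition sample_mean (R : realType) (m : nat) (z : 'I_m -> R) : R :=
  1 / m%:R * \sum_(i < m) z i.

Definition sample_variance (R : realType) (m : nat) (z : 'I_m -> R) : R :=
  1 / (m%:R * (m%:R - 1)) *
  \sum_(i < m) \sum_(j < m | (i < j)%N) (z i - z j) ^+ 2.

Definition utility_cipw (R : realType) (d : measure_display)
    (Q : measurableType d) (n m : nat)
    (PO : R.-pker (Q * n.-tuple bool)%type ~> (n.-tuple bool))
    (sigma : Q -> {set 'I_n} -> nat -> 'I_n) (lambda : R) (g : {set 'I_n})
    (t : nat) (y : 'I_m -> (Q * n.-tuple bool) * n.-tuple bool) : R :=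
  sample_mean (fun i => clipped_reward PO sigma lambda g t (y i)).

Definition utility_upper (R : realType) (d : measure_display)
    (Q : measurableType d) (n m : nat)
    (PO : R.-pker (Q * n.-tuple bool)%type ~> (n.-tuple bool))
    (sigma : Q -> {set 'I_n} -> nat -> 'I_n) (lambda : R) (g : {set 'I_n})
    (t : nat) (alpha : R)
    (y : 'I_m -> (Q * n.-tuple bool) * n.-tuple bool) : R :=
  let Z i := clipped_reward PO sigma lambda g t (y i) in
  utility_cipw PO sigma lambda g t y
  + Num.sqrt (2 * sample_variance Z * ln (4 / alpha) / m%:R)
  + 7 * t%:R * lambda * ln (4 / alpha) / (3 * (m%:R - 1))
  + t%:R * Num.sqrt (ln (2 / alpha) / (2 * m%:R))
  + 1 / m%:R * \sum_(i < m) \sum_(1 <= j < t.+1)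
      Num.max 0 (1 - lambda * propensity PO (y i).1 (sigma (y i).1.1 g j)).

(* Main.v *)
From HB Require Import structures.
Require Import Defs.
From mathcomp Require Import all_boot all_order all_algebra all_fingroup.
From mathcomp Require Import all_classical all_reals all_analysis.
From mathcomp Require Import measurable_realfun zify ring lra.
Import Order.TTheory GRing.Theory Num.Theory.
Local Open Scope classical_set_scope.
Local Open Scope ring_scope.

(* Write Z and B for the clipped reward and for the clipping bias
   sum_j max(0, 1 - lambda p^j) of one log entry.  Conditionally on the request
   the observation of an item has mean p, so the reward of an item loses at most
   r (1 - min(lambda p, 1)) <= max(0, 1 - lambda p) in expectation, whence
   U <= E Z + E B.  Hoeffding's inequality bounds E B up to probability alpha/2,
   and the empirical Bernstein bound of Maurer and Pontil bounds E Z up to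
   probability alpha/2.  The latter combines Bernstein's inequality with a lower
   tail bound for the sample variance V.  Instead of the entropy method, the
   lower tail is obtained in Hoeffding's manner: V is the average over all
   permutations of the mean of floor(m/2) independent copies of (Z - Z')^2 / 2,
   so by convexity its Laplace transform is at most that of such a mean, and
   e^(-x) <= 1 - x + x^2/2 gives a sub-Gaussian bound because
   floor(m/2) >= (m-1)/2. *)

(** * Exponential inequalities *)

Section exponential_inequalities.
Import numFieldNormedType.Exports.
Context {R : realType}.
Implicit Types x y u p a : R.

(** By the mean value theorem [g1] is nondecreasing; vanishing at 0, it has the sign of its
    argument, so that [g] is smallest at 0. *)
Lemma ge0_of_derive2_ge0 (g g1 g2 : R -> R) :
  (forall x, is_derive x 1 g (g1 x)) -> (forall x, is_derive x 1 g1 (g2 x)) ->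
  (forall x, 0 <= g2 x) -> g 0 = 0 -> g1 0 = 0 -> forall x, 0 <= g x.
Proof.
move=> dg dg1 g2_ge0 g0 g10.
have mvt (f df : R -> R) : (forall x, is_derive x 1 f (df x)) ->
    forall x y, x <= y -> exists2 c, x <= c <= y & f y - f x = df c * (y - x).
  move=> dfE x y xy.
  have [|c] := @MVT_segment R f df x y xy (fun z _ => dfE z).
  - apply: derivable_within_continuous => z _; by have [] := dfE z.
  - by rewrite in_itv/= => cxy fE; exists c.
have g1_mono x y : x <= y -> g1 x <= g1 y.
  by move=> xy; have [c _ e] := mvt _ _ dg1 _ _ xy; have := g2_ge0 c; nra.
move=> x; have [x_ge0|/ltW x_le0] := leP 0 x.
- have [c /andP[c_ge0 _]] := mvt _ _ dg _ _ x_ge0.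
  by have := g1_mono _ _ c_ge0; rewrite g10 g0; nra.
- have [c /andP[_ c_le0]] := mvt _ _ dg _ _ x_le0.
  by have := g1_mono _ _ c_le0; rewrite g10 g0; nra.
Qed.

(* Multiplying by 1 - x / 3 makes the difference of the two sides convex: its
   second derivative is (1 - e^x (1 - x)) / 3. *)
Lemma expR_le_quadratic x : x < 3 ->
  expR x <= 1 + x + x ^+ 2 / (2 * (1 - x / 3)).
Proof.
move=> x3; pose g y : R := 1 + 2 / 3 * y + y ^+ 2 / 6 - expR y * (1 - y / 3).
have : 0 <= g x.
  apply: (@ge0_of_derive2_ge0 g (fun y => 2 / 3 + y / 3 - expR y * (2 / 3 - y / 3))
    (fun y => 1 / 3 - expR y * (1 / 3 - y / 3))) => [y|y|y| |].
  - apply: is_derive_eq; rewrite /GRing.scale/=; lra.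
  - apply: is_derive_eq; rewrite /GRing.scale/=; lra.
  - have := expR_ge1Dx (- y); have := expR_gt0 y; have := expRxMexpNx_1 y; nra.
  - rewrite /g expR0; lra.
  - rewrite expR0; lra.
rewrite /g => gx.
have x3' : 0 < 1 - x / 3 by lra.
have -> : 1 + x + x ^+ 2 / (2 * (1 - x / 3)) =
    (1 + 2 / 3 * x + x ^+ 2 / 6) / (1 - x / 3).
  by field; apply/eqP; lra.
by rewrite ler_pdivlMr//; lra.
Qed.

(** Since x / 3 is at most [a], the denominator can be frozen at 1 - a. The bound becomes a
    polynomial in x, hence easy to integrate. *)
Lemma expR_le_subgamma x a : 0 <= a < 1 -> x <= 3 * a ->
  expR x <= 1 + x + x ^+ 2 / (2 * (1 - a)).
Proof.
move=> /andP[a_ge0 a_lt1] xa; apply: (le_trans (expR_le_quadratic x _));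
  first lra.
rewrite lerD2l ler_wpM2l ?sqr_ge0// lef_pV2 ?posrE; lra.
Qed.

Lemma expRN_le_quadratic x : 0 <= x -> expR (- x) <= 1 - x + x ^+ 2 / 2.
Proof.
move=> x_ge0.
by have := @expR_le_subgamma (- x) 0; rewrite sqrrN subr0 mulr1; apply; lra.
Qed.

(** Convexity of the exponential between 0 and [u], derived from its tangent at the intermediate
    point p u. *)
Lemma expR_le_chord p u : 0 <= p <= 1 -> expR (p * u) <= 1 - p + p * expR u.
Proof.
move=> /andP[p_ge0 p_le1].
have := expR_ge1Dx (- (p * u)); have := expR_ge1Dx ((1 - p) * u).
have -> : expR u = expR (p * u) * expR ((1 - p) * u).
  by rewrite -expRD; congr expR; ring.
have := expRxMexpNx_1 (p * u); have := expR_gt0 (p * u).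
set e := expR (p * u); set e1 := expR _; set e2 := expR _ => e_gt0 e12 h1 h2.
(* The tangent at p u, evaluated at 0 and at u and averaged with weights 1 - p and p, returns the
   value e at p u; each tangent value lies below the exponential. *)
rewrite [X in X <= _](_ : e =
  (1 - p) * (e * (1 - p * u)) + p * (e * (1 + (1 - p) * u))); last by ring.
apply: lerD; last by rewrite !ler_wpM2l// ltW.
rewrite -[leRHS]mulr1 ler_wpM2l ?subr_ge0//.
by rewrite -[X in _ <= X]e12 ler_wpM2l// ltW.
Qed.

(** Hoeffding's lemma for a Bernoulli variable: the log of the left-hand side has second derivative
    q (1 - q), at most 1/4, where q = p e^y / (1 - p + p e^y) is the tilted parameter. *)
Lemma bernoulli_mgf_le p u : 0 <= p <= 1 ->
  1 - p + p * expR u <= expR (p * u + u ^+ 2 / 8).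
Proof.
move=> /andP[p_ge0 p_le1].
have D_gt0 y : 0 < 1 - p + p * expR y.
  by have := expR_gt0 y; have := expR_ge1Dx y; nra.
pose g y : R := p * y + y ^+ 2 / 8 - ln (1 - p + p * expR y).
suff : 0 <= g u.
  rewrite /g subr_ge0 => h.
  by rewrite -[X in X <= _]lnK ?posrE// ler_expR.
apply: (@ge0_of_derive2_ge0 g
    (fun y => p + y / 4 - p * expR y / (1 - p + p * expR y))
    (fun y => 1 / 4 - p * expR y * (1 - p) / (1 - p + p * expR y) ^+ 2)) => [y|y|y| |].
- rewrite /g; have dln := is_derive1_ln (D_gt0 y).
  have dD : is_derive y 1 (fun z => 1 - p + p * expR z) (p * expR y).
    by apply: is_derive_eq; rewrite /GRing.scale/=; lra.
  have dlnD := @is_derive1_comp _ (@ln R) (fun z => 1 - p + p * expR z) y _ _ dln dD.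
  have := D_gt0 y => Dy.
  by apply: is_derive_eq; rewrite /GRing.scale/=; field; lra.
- have Dy := D_gt0 y.
  have dD : is_derive y 1 (fun z => 1 - p + p * expR z) (p * expR y).
    by apply: is_derive_eq; rewrite /GRing.scale/=; lra.
  have dV := @is_deriveV _ (fun z => 1 - p + p * expR z) y _ 1 (lt0r_neq0 Dy) dD.
  by apply: is_derive_eq; rewrite /GRing.scale/=; field; lra.
- have Dy := D_gt0 y; rewrite subr_ge0 ler_pdivrMr ?exprn_gt0//.
  (* This is 4 a b <= (a + b)^2 for a = 1 - p and b = p e^y. *)
  have := sqr_ge0 (1 - p - p * expR y); set e := expR y; lra.
- by rewrite /g expR0 mulr1 subrK ln1; lra.
- by rewrite expR0 mulr1 subrK; lra.
Qed.

End exponential_inequalities.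

(** * Integration against a density *)

Section ge0_integral_density.
Import numFieldNormedType.Exports HBNNSimple.
Context {d d' : measure_display} {S : measurableType d} {T : measurableType d'}
  {R : realType}.

(** Here [nu] is the image under [U] of the measure with density [Y], known through indicators.
    Linearity extends the formula to simple functions, monotone convergence to nonnegative
    measurable ones. *)
Lemma ge0_integral_density (nu : {measure set S -> \bar R})
    (mu : {measure set T -> \bar R}) (U : T -> S) (Y : T -> R) :
  measurable_fun setT U -> measurable_fun setT Y -> (forall w, 0 <= Y w) ->
  (forall C, measurable C ->
    nu C = (\int[mu]_w (\1_C (U w) * Y w)%:E)%E) ->
  forall phi : S -> R, measurable_fun setT phi -> (forall x, 0 <= phi x) ->
  (\int[nu]_x (phi x)%:E = \int[mu]_w (phi (U w) * Y w)%:E)%E.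
Proof.
move=> mU mY Y_ge0 nuE phi mphi phi_ge0.
have sfun_case (h : {nnsfun S >-> R}) :
    (\int[nu]_x (h x)%:E = \int[mu]_w (h (U w) * Y w)%:E)%E.
  have mh r : measurable (h @^-1` [set r]) by exact: measurable_sfunP.
  have mind r : measurable_fun setT (fun w => \1_(h @^-1` [set r]) (U w) : R).
    by apply: measurableT_comp => //; exact: measurable_indic.
  have hE w : ((h (U w) * Y w)%:E =
      \sum_(r \in range h) (r * (\1_(h @^-1` [set r]) (U w) * Y w))%:E)%E.
    rewrite fimfunE EFinM -fsumEFin// ge0_mule_fsuml => [|r]; last first.
      by rewrite EFinM nnfun_muleindic_ge0.
    by apply: eq_fsbigr => r _; rewrite -EFinM mulrA.
  under [RHS]eq_integral do rewrite hE.
  rewrite ge0_integral_fsum//; last 2 first.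
  - by move=> r; apply/measurable_EFinP; do 2 apply: measurable_funM => //.
  - move=> r w _; rewrite mulrA EFinM mule_ge0 ?lee_fin//.
    by rewrite -lee_fin EFinM nnfun_muleindic_ge0.
  rewrite integralT_nnsfun sintegralE; apply: eq_fsbigr => r /[!inE] -[x _ <-].
  rewrite nuE// -ge0_integralZl//.
  - by apply/measurable_EFinP; apply: measurable_funM.
  - by move=> w _; rewrite lee_fin mulr_ge0.
  - by rewrite lee_fin.
have mphiE : measurable_fun setT (EFin \o phi) by exact/measurable_EFinP.
pose f_ := nnsfun_approx measurableT mphiE.
have f_cvg x : (EFin \o f_ ^~ x) n @[n --> \oo] --> (phi x)%:E.
  by apply: cvg_nnsfun_approx => // y _; rewrite lee_fin.
have f_nd x m n : (m <= n)%N -> f_ m x <= f_ n x.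
  by move=> mn; exact/lefP/nd_nnsfun_approx.
transitivity (limn (fun n => \int[nu]_x (f_ n x)%:E)%E).
  rewrite -monotone_convergence//.
  - by apply: eq_integral => x _; apply/esym/cvg_lim => //; exact: f_cvg.
  - by move=> n; exact/measurable_EFinP.
  - by move=> n x _; rewrite lee_fin.
  - by move=> x _ m n mn; rewrite lee_fin f_nd.
under eq_fun do rewrite sfun_case.
rewrite -monotone_convergence//.
- apply: eq_integral => w _; apply/cvg_lim => //.
  under eq_fun do rewrite EFinM.
  by rewrite EFinM; apply: cvgeZr => //; exact: f_cvg.
- move=> n; apply/measurable_EFinP; apply: measurable_funM => //.
  by apply: measurableT_comp => //; exact: measurable_funP.
- by move=> n w _; rewrite lee_fin mulr_ge0.
- by move=> w _ m n mn; rewrite lee_fin ler_wpM2r ?f_nd.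
Qed.

End ge0_integral_density.

(** * Products of independent functions *)

Section weighted_measure.
Context {d : measure_display} {T : measurableType d} {R : realType}.
Variables (mu : {measure set T -> \bar R}) (Y : T -> R).
Hypotheses (mY : measurable_fun setT Y) (Y_ge0 : forall w, 0 <= Y w).

(* The proof arguments only serve to infer the measure structure below. *)
Definition weighted of measurable_fun setT Y & (forall w, 0 <= Y w) :=
  fun A : set T => (\int[mu]_(w in A) (Y w)%:E)%E.

Local Notation nu := (weighted mY Y_ge0).

Let nu0 : nu set0 = 0%E.
Proof. by rewrite /weighted integral_set0. Qed.

Let nu_ge0 A : (0 <= nu A)%E.
Proof. by apply: integral_ge0 => w _; rewrite lee_fin. Qed.

Let nu_semi_sigma_additive : semi_sigma_additive nu.
Proof.
by apply: semi_sigma_additive_nng_induced => [|w]; rewrite ?lee_fin//;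
  exact/measurable_EFinP.
Qed.

HB.instance Definition _ :=
  isMeasure.Build _ _ _ nu nu0 nu_ge0 nu_semi_sigma_additive.

Lemma weightedE A : nu A = (\int[mu]_w (\1_A w * Y w)%:E)%E.
Proof.
rewrite /weighted integral_mkcond; apply: eq_integral => w _.
by rewrite epatch_indic/= -EFinM mulrC.
Qed.

End weighted_measure.

Section independence.
Context {d d' : measure_display} {Omega : measurableType d}
  {T : measurableType d'} {R : realType} {I : finType}.
Variables (P : probability Omega R) (nu : probability T R)
  (W : I -> Omega -> T).
Hypotheses (mW : forall i, measurable_fun setT (W i))
  (indepW : mutually_independent P W)
  (lawW : forall i A, measurable A -> P (W i @^-1` A) = nu A).

Let mcomp (h : T -> R) i :
  measurable_fun setT h -> measurable_fun setT (fun w => h (W i w)).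
Proof. by move=> mh; exact: measurableT_comp. Qed.

Let mprod (h : I -> T -> R) (s : seq I) :
  (forall i, measurable_fun setT (h i)) ->
  measurable_fun setT (fun w => \prod_(i <- s) h i (W i w)).
Proof. by move=> mh; apply: measurable_prod => i _; exact: mcomp. Qed.

(** The defining product rule for events, restated for integrals and for duplicate-free sequences,
    on which the inductions below run. *)
Let indep_indic (s : seq I) (B : I -> set T) : uniq s ->
  (forall i, measurable (B i)) ->
  (\int[P]_w (\prod_(i <- s) \1_(B i) (W i w))%:E =
   (\prod_(i <- s) fine (nu (B i)))%:E)%E.
Proof.
move=> s_uniq mB.
have := indepW [set i in s]%SET B (fun i _ => mB i).
have -> : [set w | forall i, i \in [set i0 in s]%SET -> B i (W i w)] =
    [set w | forall i, i \in s -> B i (W i w)].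
  by apply/seteqP; split=> w /= h i is_; apply: h; rewrite inE in is_ *.
move=> PE; transitivity (P [set w | forall i, i \in s -> B i (W i w)]).
  rewrite -[X in P X]setIT -integral_indic//; last first.
    rewrite (_ : [set w | _] = \bigcap_(i in [set` s]) (W i @^-1` B i)).
      apply: fin_bigcap_measurable => // i _.
      by rewrite -[X in measurable X]setTI; exact: mW.
    by apply/seteqP; split.
  apply: eq_integral => w _; congr EFin.
  have [h|nh] := pselect (forall i, i \in s -> B i (W i w)).
    rewrite [LHS]big_seq big1 => [|i /h Bi]; rewrite indicE mem_set//.
  rewrite [RHS]indicE memNset//.
  have /existsNP[i /not_implyP[is_ nB]] := nh.
  by rewrite (big_rem i)//= indicE memNset// mul0r.
rewrite PE -prodEFin.
rewrite (eq_bigl [in s]) => [|i]; last by rewrite inE.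
by rewrite -big_uniq//; apply: eq_bigr => i _;
  rewrite fineK ?fin_num_measure ?lawW.
Qed.

(** Indicators are exchanged for functions one index at a time. With an arbitrary indicator at the
    head index the identity is the induction hypothesis; [ge0_integral_density] then upgrades that
    indicator to [h a]. *)
Let indep_prod_indic (h : I -> T -> R) (e : I -> R) (s : seq I) :
  (forall i, measurable_fun setT (h i)) -> (forall i x, 0 <= h i x) ->
  (forall i, (\int[nu]_x (h i x)%:E = (e i)%:E)%E) ->
  forall (r : seq I) (B : I -> set T), uniq (s ++ r) ->
  (forall i, measurable (B i)) ->
  (\int[P]_w (\prod_(i <- s) h i (W i w) *
              \prod_(i <- r) \1_(B i) (W i w))%:E =
   (\prod_(i <- s) e i * \prod_(i <- r) fine (nu (B i)))%:E)%E.
Proof.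
move=> mh h_ge0 hE.
have e_ge0 i : 0 <= e i.
  by rewrite -lee_fin -hE; apply: integral_ge0 => x _; rewrite lee_fin.
elim: s => [|a s IH] r B.
  move=> r_uniq mB; rewrite big_nil mul1r -indep_indic//.
  by apply: eq_integral => w _; rewrite big_nil mul1r.
rewrite cat_cons => /= /andP[]; rewrite mem_cat negb_or => /andP[a_s a_r].
move=> sr_uniq mB.
(* [Y] collects all factors except the one at [a] and serves as the density. *)
pose Y w := \prod_(i <- s) h i (W i w) * \prod_(i <- r) \1_(B i) (W i w) : R.
have mY : measurable_fun setT Y.
  apply: measurable_funM; first exact: mprod.
  by apply: (mprod (fun i => \1_(B i))) => i; exact: measurable_indic.
have Y_ge0 w : 0 <= Y w by rewrite mulr_ge0// prodr_ge0.
have c_ge0 : 0 <= \prod_(i <- s) e i * \prod_(i <- r) fine (nu (B i)).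
  by rewrite mulr_ge0// prodr_ge0// => i _; rewrite fine_ge0.
have mscaleE C : measurable C -> mscale (NngNum c_ge0) nu C =
    (\int[P]_w (\1_C (W a w) * Y w)%:E)%E.
  (* Since [a] does not occur in [r], redefining the set at [a] leaves the other indicators
     unchanged. *)
  move=> mC; pose B' i := if i == a then C else B i.
  have B'a : B' a = C by rewrite /B' eqxx.
  have mB' i : measurable (B' i) by rewrite /B'; case: ifP.
  have eqB' (F : set T -> I -> R) :
      \prod_(i <- r) F (B' i) i = \prod_(i <- r) F (B i) i.
    rewrite big_seq [RHS]big_seq; apply: eq_bigr => i ir; rewrite /B'.
    by case: eqP => // ia; rewrite -ia ir in a_r.
  have sar_uniq : uniq (s ++ a :: r).
    by rewrite -cat1s uniq_catCA/= mem_cat negb_or a_s a_r.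
  have := IH (a :: r) B' sar_uniq mB'.
  rewrite big_cons (eqB' (fun C _ => fine (nu C))) B'a.
  rewrite mulrCA EFinM fineK ?fin_num_measure// /mscale/= muleC => <-.
  apply: eq_integral => w _.
  rewrite big_cons (eqB' (fun C i => \1_C (W i w))) B'a.
  by rewrite /Y mulrCA.
have := ge0_integral_density _ _ _ _ (mW a) mY Y_ge0 mscaleE (h a) (mh a) (h_ge0 a).
rewrite ge0_integral_mscale//; last 2 first.
- exact/measurable_EFinP.
- by move=> x _; rewrite lee_fin.
rewrite hE -EFinM/= big_cons mulrC mulrA => ->.
by apply: eq_integral => w _; rewrite big_cons mulrA.
Qed.

Lemma integral_prod_indep (h : I -> T -> R) (e : I -> R) (s : seq I) :
  (forall i, measurable_fun setT (h i)) -> (forall i x, 0 <= h i x) ->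
  (forall i, (\int[nu]_x (h i x)%:E = (e i)%:E)%E) -> uniq s ->
  (\int[P]_w (\prod_(i <- s) h i (W i w))%:E = (\prod_(i <- s) e i)%:E)%E.
Proof.
move=> mh h_ge0 hE s_uniq.
have := indep_prod_indic h e s mh h_ge0 hE [::] (fun=> setT).
rewrite cats0 big_nil mulr1 => <-//.
by apply: eq_integral => w _; rewrite big_nil mulr1.
Qed.

(* The factors [h i] make the induction on [s] work: the indicator of a rectangle
   in a pair of coordinates is a product of two such factors, and product
   measures are determined by rectangles. *)
Lemma integral_prod_indep_pairs (psi : T * T -> R) (e2 : R) (s : seq (I * I)) :
  measurable_fun setT psi -> (forall x, 0 <= psi x) ->
  (\int[(nu \x nu)%E]_x (psi x)%:E = e2%:E)%E ->
  forall (r : seq I) (h : I -> T -> R) (e : I -> R),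
  uniq (unzip1 s ++ unzip2 s ++ r) ->
  (forall i, measurable_fun setT (h i)) -> (forall i x, 0 <= h i x) ->
  (forall i, (\int[nu]_x (h i x)%:E = (e i)%:E)%E) ->
  (\int[P]_w (\prod_(p <- s) psi (W p.1 w, W p.2 w) *
              \prod_(i <- r) h i (W i w))%:E =
   (e2 ^+ size s * \prod_(i <- r) e i)%:E)%E.
Proof.
move=> mpsi psi_ge0 psiE.
have e2_ge0 : 0 <= e2.
  by rewrite -lee_fin -psiE; apply: integral_ge0 => x _; rewrite lee_fin.
elim: s => [|[a b] s IH] r h e.
  move=> r_uniq mh h_ge0 hE; rewrite expr0 mul1r -(integral_prod_indep h)//.
  by apply: eq_integral => w _; rewrite big_nil mul1r.
move=> abs_uniq mh h_ge0 hE.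
have e_ge0 i : 0 <= e i.
  by rewrite -lee_fin -hE; apply: integral_ge0 => x _; rewrite lee_fin.
have sabr_uniq : uniq (unzip1 s ++ unzip2 s ++ [:: a, b & r]).
  rewrite -(perm_uniq (s1 := unzip1 ((a, b) :: s) ++ unzip2 ((a, b) :: s) ++ r))//.
  by apply/seq.permP => p; rewrite /= !count_cat/= !count_cat/=; lia.
have [ab a_r b_r] : [/\ a != b, a \notin r & b \notin r].
  move: sabr_uniq; rewrite catA uniq_catC/= inE !mem_cat !negb_or.
  by case/andP => /and3P[-> -> _] /andP[/andP[-> _] _].
pose Y w := \prod_(p <- s) psi (W p.1 w, W p.2 w) * \prod_(i <- r) h i (W i w) : R.
have mU i j : measurable_fun setT (fun w => (W i w, W j w)).
  exact: measurable_fun_pair.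
have mY : measurable_fun setT Y.
  apply: measurable_funM; last exact: mprod.
  apply: measurable_prod => p _.
  exact: (measurableT_comp mpsi (mU p.1 p.2)).
have Y_ge0 w : 0 <= Y w by rewrite mulr_ge0// prodr_ge0.
have c_ge0 : 0 <= e2 ^+ size s * \prod_(i <- r) e i.
  by rewrite mulr_ge0 ?exprn_ge0// prodr_ge0.
(* Loading the constant onto the first factor keeps the target a product measure, to which
   uniqueness on rectangles applies. *)
pose m1 := mscale (NngNum c_ge0) nu.
pose m' := pushforward (weighted P Y mY Y_ge0) (fun w => (W a w, W b w)).
have rectangle A B : measurable A -> measurable B ->
    m' (A `*` B) = (m1 A * nu B)%E.
  move=> mA mB; rewrite /m' /pushforward weightedE.
  pose h' i := if i == a then \1_A else if i == b then \1_B else h i.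
  pose e' i := if i == a then fine (nu A) else if i == b then fine (nu B) else e i.
  have h'E w : \prod_(i <- r) h' i (W i w) = \prod_(i <- r) h i (W i w).
    rewrite big_seq [RHS]big_seq; apply: eq_bigr => i ir; rewrite /h'.
    case: eqP => [ia|_]; first by rewrite -ia ir in a_r.
    by case: eqP => // ib; rewrite -ib ir in b_r.
  have e'E : \prod_(i <- r) e' i = \prod_(i <- r) e i.
    rewrite big_seq [RHS]big_seq; apply: eq_bigr => i ir; rewrite /e'.
    case: eqP => [ia|_]; first by rewrite -ia ir in a_r.
    by case: eqP => // ib; rewrite -ib ir in b_r.
  have := IH [:: a, b & r] h' e' sabr_uniq.
  rewrite !big_cons e'E /e' eqxx eq_sym (negbTE ab) eqxx.
  rewrite /m1 /mscale/= => IHab.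
  rewrite (_ : (_ * _)%E = (e2 ^+ size s *
    (fine (nu A) * (fine (nu B) * \prod_(j <- r) e j)))%:E); last first.
    rewrite -[nu A]fineK ?fin_num_measure// -[nu B]fineK ?fin_num_measure//.
    by rewrite -!EFinM/=; congr EFin; ring.
  rewrite -IHab.
  - apply: eq_integral => w _; congr EFin.
    rewrite !big_cons h'E /h' eqxx eq_sym (negbTE ab) eqxx /Y.
    rewrite (_ : \1__ w = \1_A (W a w) * \1_B (W b w)); first by ring.
    rewrite !indicE -natrM mulnb; congr (nat_of_bool _)%:R.
    by apply/idP/andP; rewrite !inE.
  - by move=> i; rewrite /h'; do 2?case: ifP => _ //; exact: measurable_indic.
  - by move=> i x; rewrite /h'; do 2?case: ifP => _ //.
  - move=> i; rewrite /h' /e'; do 2?[case: ifP => _]; rewrite ?hE//.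
    + by rewrite integral_indic// setIT fineK ?fin_num_measure.
    + by rewrite integral_indic// setIT fineK ?fin_num_measure.
have densE C : measurable C -> (m1 \x nu)%E C =
    (\int[P]_w (\1_C (W a w, W b w) * Y w)%:E)%E.
  move=> mC; transitivity (m' C); first exact: product_measure_unique.
  by rewrite /m' /pushforward weightedE; apply: eq_integral.
have := ge0_integral_density _ _ _ _ (mU a b) mY Y_ge0 densE psi mpsi psi_ge0.
have mpsiE : measurable_fun setT (EFin \o psi) by exact/measurable_EFinP.
(* Tonelli's theorem, used in both directions, extracts the constant from the first factor. *)
rewrite fubini_tonelli1// ge0_integral_mscale//; last 2 first.
- exact: measurable_fun_fubini_tonelli_F.
- by move=> x _; apply: integral_ge0 => y _; rewrite lee_fin.
rewrite -fubini_tonelli1//.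
rewrite psiE -EFinM/= exprS mulrC mulrA => ->.
by apply: eq_integral => w _; rewrite big_cons mulrA.
Qed.

End independence.

(** * Deviation of the sample mean *)

Section bounded_measurable.
Context {d : measure_display} {T : measurableType d} {R : realType}.
Implicit Types f g : T -> R.

(** A class stable under the algebraic operations and the exponential, on which integrals against a
    probability are finite, so that real-valued integrals are linear and monotone. *)
Definition bounded_measurable f :=
  measurable_fun setT f /\ exists M, forall x, `|f x| <= M.

Lemma bounded_measurable_cst (c : R) : bounded_measurable (fun=> c).
Proof. by split=> //; exists `|c|. Qed.

Lemma bounded_measurableD f g : bounded_measurable f -> bounded_measurable g ->
  bounded_measurable (fun x => f x + g x).
Proof.
move=> [mf [M fM]] [mg [N gN]]; split; first exact: measurable_funD.
by exists (M + N) => x; rewrite (le_trans (ler_normD _ _))// lerD.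
Qed.

Lemma bounded_measurableM f g : bounded_measurable f -> bounded_measurable g ->
  bounded_measurable (fun x => f x * g x).
Proof.
move=> [mf [M fM]] [mg [N gN]]; split; first exact: measurable_funM.
by exists (M * N) => x; rewrite normrM ler_pM.
Qed.

Lemma bounded_measurableZ (c : R) f : bounded_measurable f ->
  bounded_measurable (fun x => c * f x).
Proof. exact/bounded_measurableM/bounded_measurable_cst. Qed.

Lemma bounded_measurableB f g : bounded_measurable f -> bounded_measurable g ->
  bounded_measurable (fun x => f x - g x).
Proof.
move=> bf bg; have := bounded_measurableD _ _ bf (bounded_measurableZ (-1) _ bg).
by under eq_fun do rewrite mulN1r.
Qed.

Lemma bounded_measurable_sum {I : Type} (r : seq I) (F : I -> T -> R) :
  (forall i, bounded_measurable (F i)) ->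
  bounded_measurable (fun x => \sum_(i <- r) F i x).
Proof.
move=> bF; elim: r => [|i r IH].
  by under eq_fun do rewrite big_nil; exact: bounded_measurable_cst.
by under eq_fun do rewrite big_cons; exact: bounded_measurableD.
Qed.

Lemma bounded_measurableX n f : bounded_measurable f ->
  bounded_measurable (fun x => f x ^+ n).
Proof.
move=> bf; elim: n => [|n IH]; first exact: bounded_measurable_cst.
by under eq_fun do rewrite exprS; exact: bounded_measurableM.
Qed.

Lemma bounded_measurable_expR f : bounded_measurable f ->
  bounded_measurable (fun x => expR (f x)).
Proof.
move=> [mf [M fM]]; split; first exact: measurableT_comp.
by exists (expR M) => x;
  rewrite ger0_norm ?expR_ge0// ler_expR (le_trans (ler_norm _)).
Qed.

Lemma bounded_measurable_itv f (a b : R) : measurable_fun setT f ->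
  (forall x, a <= f x <= b) -> bounded_measurable f.
Proof.
move=> mf fab; split=> //; exists (`|a| + `|b|) => x.
have /andP[af fb] := fab x; rewrite ler_norml.
have := ler_norm b; have := ler_norm (- a); rewrite normrN.
have := normr_ge0 a; have := normr_ge0 b; lra.
Qed.

Lemma measurable_set_lt f g : measurable_fun setT f -> measurable_fun setT g ->
  measurable [set x | f x < g x].
Proof.
move=> mf mg; rewrite -[X in measurable X]setTI.
under eq_set do rewrite -lte_fin.
by apply: measurable_lte => //; exact/measurable_EFinP.
Qed.

Variable mu : probability T R.

Lemma bounded_measurable_integrable f : bounded_measurable f ->
  mu.-integrable setT (EFin \o f).
Proof.
move=> [mf [M fM]]; apply: measurable_bounded_integrable => //.
  by rewrite (@le_lt_trans _ _ 1%E) ?probability_le1 ?ltry.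
exists M; split; first exact: num_real.
by move=> N MN x _; exact/(le_trans (fM x))/ltW.
Qed.

Lemma EFin_Rintegral f : bounded_measurable f ->
  (\int[mu]_x (f x)%:E)%E = (\int[mu]_x f x)%:E.
Proof.
move=> bf; rewrite /Rintegral fineK//.
by apply: integrable_fin_num => //; exact: bounded_measurable_integrable.
Qed.

Lemma Rintegral_bmD f g : bounded_measurable f -> bounded_measurable g ->
  \int[mu]_x (f x + g x) = \int[mu]_x f x + \int[mu]_x g x.
Proof. by move=> bf bg; rewrite RintegralD//;
  exact: bounded_measurable_integrable. Qed.

Lemma Rintegral_bmB f g : bounded_measurable f -> bounded_measurable g ->
  \int[mu]_x (f x - g x) = \int[mu]_x f x - \int[mu]_x g x.
Proof. by move=> bf bg; rewrite RintegralB//;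
  exact: bounded_measurable_integrable. Qed.

Lemma Rintegral_bmZ (c : R) f : bounded_measurable f ->
  \int[mu]_x (c * f x) = c * \int[mu]_x f x.
Proof. by move=> bf; rewrite RintegralZl//;
  exact: bounded_measurable_integrable. Qed.

Lemma Rintegral_prob_cst (c : R) : \int[mu]_x c = c.
Proof.
transitivity (c * fine (mu setT)); first exact: Rintegral_cst.
by rewrite probability_setT mulr1.
Qed.

Lemma Rintegral_bm_sum {I : Type} (r : seq I) (F : I -> T -> R) :
  (forall i, bounded_measurable (F i)) ->
  \int[mu]_x (\sum_(i <- r) F i x) = \sum_(i <- r) \int[mu]_x F i x.
Proof.
move=> bF; elim: r => [|i r IH].
  by rewrite big_nil -[RHS]Rintegral_prob_cst; apply: eq_Rintegral => x _;
    rewrite big_nil.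
rewrite big_cons -IH -Rintegral_bmD//; last exact: bounded_measurable_sum.
by apply: eq_Rintegral => x _; rewrite big_cons.
Qed.

Lemma Rintegral_bm_le f g : bounded_measurable f -> bounded_measurable g ->
  (forall x, f x <= g x) -> \int[mu]_x f x <= \int[mu]_x g x.
Proof.
by move=> bf bg fg; apply: le_Rintegral => //;
  exact: bounded_measurable_integrable.
Qed.

Lemma Rintegral_itv f (a b : R) : measurable_fun setT f ->
  (forall x, a <= f x <= b) -> a <= \int[mu]_x f x <= b.
Proof.
move=> mf fab; have bf := bounded_measurable_itv _ _ _ mf fab.
rewrite -{1}(Rintegral_prob_cst a) -[X in _ <= _ <= X](Rintegral_prob_cst b).
by apply/andP; split; apply: Rintegral_bm_le => //;
  [exact: bounded_measurable_cst|move=> x|exact: bounded_measurable_cst|move=> x];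
  have /andP[] := fab x.
Qed.

(** Markov's inequality at threshold 1: [Y] dominates the indicator of [A]. *)
Lemma probability_le_integral (A : set T) (Y : T -> R) (c : R) :
  measurable A -> measurable_fun setT Y -> (forall w, 0 <= Y w) ->
  (forall w, A w -> 1 <= Y w) -> (\int[mu]_w (Y w)%:E <= c%:E)%E ->
  (mu A <= c%:E)%E.
Proof.
move=> mA mY Y_ge0 YA; apply: le_trans.
rewrite -[X in mu X]setIT -integral_indic//; apply: ge0_le_integral => //.
- exact/measurable_EFinP/measurable_indic.
- exact/measurable_EFinP.
- move=> w _; rewrite lee_fin indicE;
    case: (boolP (w \in A)) => [/set_mem/YA//|_].
  exact: Y_ge0.
Qed.

End bounded_measurable.

(** * Chernoff, Bernstein and Hoeffding bounds for the sample mean *)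

Section mean_deviation.
Context {d d' : measure_display} {Omega : measurableType d}
  {T : measurableType d'} {R : realType} {m : nat}.
Variables (P : probability Omega R) (nu : probability T R)
  (W : 'I_m -> Omega -> T).
Hypotheses (m_gt0 : (0 < m)%N) (mW : forall i, measurable_fun setT (W i))
  (indepW : mutually_independent P W)
  (lawW : forall i A, measurable A -> P (W i @^-1` A) = nu A).
Variables (h : T -> R).
Hypotheses (bh : bounded_measurable h).

Let m_gt0R : (0 : R) < m%:R. Proof. by rewrite ltr0n. Qed.

Lemma measurable_sample_mean :
  measurable_fun setT (fun w => sample_mean (fun i => h (W i w))).
Proof.
rewrite /sample_mean; apply: measurable_funM => //; apply: measurable_sum => i.
by apply: measurableT_comp => //; case: bh.
Qed.

Lemma measurable_sample_variance :
  measurable_fun setT (fun w => sample_variance (fun i => h (W i w))).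
Proof.
rewrite /sample_variance; apply: measurable_funM => //.
apply: measurable_sum => i.
under eq_fun do rewrite big_mkcond; apply: measurable_sum => j.
case: (i < j)%N => //; apply: measurable_funX; apply: measurable_funB;
  by apply: measurableT_comp => //; case: bh.
Qed.

Local Notation mu := (\int[nu]_x h x).

(** Markov's inequality for the exponential of m s (mu - mean - eps), whose expectation factorizes
    over the independent entries. *)
Lemma chernoff_mean (s K eps : R) : 0 <= s ->
  \int[nu]_x expR (s * (mu - h x)) <= expR K ->
  (P [set w | (eps < mu - sample_mean (fun i => h (W i w)))%R] <=
    (expR (m%:R * (K - s * eps)))%:E)%E.
Proof.
move=> s_ge0 mgf.
have bexp : bounded_measurable (fun x => expR (s * (mu - h x))).
  apply: bounded_measurable_expR; apply: bounded_measurableZ.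
  exact/bounded_measurableB/bh/bounded_measurable_cst.
have mexp i : measurable_fun setT (fun w => expR (s * (mu - h (W i w)))).
  exact: (measurableT_comp bexp.1 (mW i)).
have mprod : measurable_fun setT (fun w => \prod_(i < m) expR (s * (mu - h (W i w)))).
  exact: measurable_prod.
apply: (probability_le_integral _ _
    (fun w => expR (- (m%:R * (s * eps))) * \prod_(i < m) expR (s * (mu - h (W i w))))).
- apply: measurable_set_lt => //.
  exact/measurable_funB/measurable_sample_mean.
- exact: measurable_funM.
- by move=> w; rewrite mulr_ge0 ?expR_ge0// prodr_ge0// => i _; exact: expR_ge0.
- move=> w /= eps_lt; rewrite -expR_sum -expRD -[leLHS]expR0 ler_expR.
  set S := sample_mean _ in eps_lt.
  have -> : \sum_(i < m) s * (mu - h (W i w)) = m%:R * (s * (mu - S)).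
    rewrite -mulr_sumr big_split/= sumr_const card_ord sumrN /S /sample_mean.
    by rewrite -mulr_natr; field; rewrite gt_eqF.
  rewrite (_ : _ + _ = m%:R * (s * (mu - S - eps))); last by ring.
  by rewrite !mulr_ge0 ?ler0n// subr_ge0 ltW.
- under eq_integral do rewrite EFinM.
  rewrite ge0_integralZl//; last 2 first.
  + exact/measurable_EFinP.
  + by move=> w _; rewrite lee_fin prodr_ge0// => i _; exact: expR_ge0.
  rewrite (integral_prod_indep P nu W mW indepW lawW
    (fun _ x => expR (s * (mu - h x)))
    (fun=> \int[nu]_x expR (s * (mu - h x))))//.
  + rewrite -EFinM lee_fin prodr_const card_ord mulrBr expRD mulrC.
    rewrite ler_pM2r ?expR_gt0// expRM_natl lerXn2r ?nnegrE ?expR_ge0//.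
    by apply: Rintegral_ge0 => x _; exact: expR_ge0.
  + by move=> _; case: bexp.
  + by move=> _; exact: EFin_Rintegral.
  + exact: index_enum_uniq.
Qed.

(** The sub-gamma bound with a = s b / 3 controls the log-Laplace transform by s^2 v / (2 (1 - s b /
    3)); [chernoff_mean] is then applied at the best [s]. *)
Lemma bernstein_mean (b v L : R) : (forall x, 0 <= h x <= b) -> 0 < b ->
  0 < v -> \int[nu]_x (h x - mu) ^+ 2 <= v -> 0 < L ->
  (P [set w | (Num.sqrt (2 * v * L / m%:R) + b * L / (3 * m%:R) <
              mu - sample_mean (fun i => h (W i w)))%R] <= (expR (- L))%:E)%E.
Proof.
move=> h0b b_gt0 v_gt0 var_le L_gt0.
have /andP[mu_ge0 mu_le] := Rintegral_itv nu h 0 b bh.1 h0b.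
pose l := L / m%:R; have l_gt0 : 0 < l by rewrite divr_gt0.
(* Chosen so that v = 2 l q^2: the optimization then involves only rational expressions in [l], [q]
   and [c]. *)
pose q := Num.sqrt (v / (2 * l)).
have q_gt0 : 0 < q by rewrite sqrtr_gt0 divr_gt0// mulr_gt0.
have q2 : q ^+ 2 = v / (2 * l) by rewrite sqr_sqrtr// ltW// divr_gt0// mulr_gt0.
have vE : v = 2 * l * q ^+ 2 by rewrite q2; field; lra.
pose c := b / 3; have c_gt0 : 0 < c by rewrite /c; lra.
(* The minimizer of [v s / (2 (1 - c s)) + l / s]. *)
pose s := (c + q)^-1; have s_gt0 : 0 < s by rewrite invr_gt0 addr_gt0.
have sE : s * (c + q) = 1 by rewrite mulVf// gt_eqF// addr_gt0.
have sc1 : 1 - s * c = s * q by rewrite -sE; ring.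
have -> : Num.sqrt (2 * v * L / m%:R) + b * L / (3 * m%:R) = 2 * l * q + c * l.
  congr (_ + _); last by rewrite /c /l; field; rewrite gt_eqF.
  rewrite (_ : 2 * v * L / m%:R = (2 * l * q) ^+ 2); last first.
    by rewrite vE /l; field; rewrite gt_eqF.
  by rewrite sqrtr_sqr gtr0_norm// mulr_gt0// mulr_gt0.
(* With K = s l q, the exponent K - s eps is - s (c + q) l, which is - l by the choice of [s]. *)
have -> : - L = m%:R * (s * l * q - s * (2 * l * q + c * l)).
  have -> : s * l * q - s * (2 * l * q + c * l) = - (s * (c + q)) * l by ring.
  by rewrite sE /l; field; rewrite gt_eqF.
apply: chernoff_mean; first exact: ltW.
have bB : bounded_measurable (fun x => s * (mu - h x)).
  exact/bounded_measurableZ/bounded_measurableB/bh/bounded_measurable_cst.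
apply: (@le_trans _ _ (1 + s * l * q)); last exact: expR_ge1Dx.
apply: (@le_trans _ _ (\int[nu]_x
   (1 + s * (mu - h x) + (s * (mu - h x)) ^+ 2 / (2 * (1 - s * c))))).
  apply: Rintegral_bm_le.
  - exact: bounded_measurable_expR.
  - apply: bounded_measurableD; last first.
      apply: bounded_measurableM; last exact: bounded_measurable_cst.
      exact: bounded_measurableX.
    exact/bounded_measurableD/bB/bounded_measurable_cst.
  - move=> x; apply: expR_le_subgamma.
      by have := mulr_gt0 s_gt0 c_gt0; have := mulr_gt0 s_gt0 q_gt0; lra.
    have -> : 3 * (s * c) = s * b by rewrite /c; field.
    by rewrite ler_wpM2l ?(ltW s_gt0)//; have := h0b x; lra.
(* As 1 - s c = s q, the quadratic coefficient s^2 / (2 (1 - s c)) equals s / (2 q); the linear term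
   integrates to 0. *)
have -> : (fun x => 1 + s * (mu - h x) + (s * (mu - h x)) ^+ 2 / (2 * (1 - s * c))) =
    (fun x => (1 + s * mu - s * h x) + s / (2 * q) * (h x - mu) ^+ 2).
  apply/funext => x; rewrite sc1; field; rewrite !gt_eqF//.
have bv : bounded_measurable (fun x => (h x - mu) ^+ 2).
  exact/bounded_measurableX/bounded_measurableB/bounded_measurable_cst.
rewrite Rintegral_bmD; last 2 first.
- exact/bounded_measurableB/bounded_measurableZ/bh/bounded_measurable_cst.
- exact: bounded_measurableZ.
rewrite Rintegral_bmB ?Rintegral_bmZ//; last 2 first.
- exact: bounded_measurable_cst.
- exact: bounded_measurableZ.
rewrite Rintegral_prob_cst addrK lerD2l.
apply: (@le_trans _ _ (s / (2 * q) * v)).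
  by rewrite ler_wpM2l// ltW// divr_gt0// mulr_gt0.
rewrite le_eqVlt; apply/orP; left; apply/eqP; rewrite vE; field.
by rewrite gt_eqF.
Qed.

(** Convexity compares [h] with b times a Bernoulli variable of the same mean, whose Laplace
    transform [bernoulli_mgf_le] controls. *)
Lemma hoeffding_mean (b L : R) : (forall x, 0 <= h x <= b) -> 0 < b -> 0 < L ->
  (P [set w | (b * Num.sqrt (L / (2 * m%:R)) <
              mu - sample_mean (fun i => h (W i w)))%R] <= (expR (- L))%:E)%E.
Proof.
move=> h0b b_gt0 L_gt0.
have /andP[mu_ge0 mu_le] := Rintegral_itv nu h 0 b bh.1 h0b.
pose r := Num.sqrt (L / (2 * m%:R)).
have r2 : r ^+ 2 = L / (2 * m%:R) by rewrite sqr_sqrtr// ltW// divr_gt0// mulr_gt0.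
(* The minimizer of (s b)^2 / 8 - s b r, with minimum - 2 r^2. *)
pose s := 4 * r / b.
have s_ge0 : 0 <= s by rewrite divr_ge0 ?(ltW b_gt0)// mulr_ge0// sqrtr_ge0.
have -> : - L = m%:R * ((s * b) ^+ 2 / 8 - s * (b * r)).
  have -> : (s * b) ^+ 2 / 8 - s * (b * r) = - 2 * r ^+ 2.
    by rewrite /s; field; rewrite gt_eqF.
  by rewrite r2; field; rewrite gt_eqF.
apply: chernoff_mean => //.
have p01 : 0 <= mu / b <= 1 by rewrite divr_ge0 ?(ltW b_gt0)//= ler_pdivrMr// mul1r.
(* The chord bound is affine in [h x], so its integral depends on [mu] only. *)
pose g x := expR (s * mu) * (1 - h x / b + h x / b * expR (- (s * b))).
have gE x : g x = expR (s * mu) + expR (s * mu) * (expR (- (s * b)) - 1) / b * h x.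
  by rewrite /g; field; rewrite gt_eqF.
have bg : bounded_measurable g.
  rewrite (funext gE); apply: bounded_measurableD;
    first exact: bounded_measurable_cst.
  exact: bounded_measurableZ.
apply: (@le_trans _ _ (\int[nu]_x g x)).
  apply: Rintegral_bm_le => //.
    apply: bounded_measurable_expR.
    exact/bounded_measurableZ/bounded_measurableB/bh/bounded_measurable_cst.
  move=> x; rewrite mulrBr expRD ler_wpM2l ?expR_ge0//.
  have -> : - (s * h x) = h x / b * - (s * b) by field; rewrite gt_eqF.
  apply: expR_le_chord.
  by have /andP[hx0 hxb] := h0b x;
    rewrite divr_ge0 ?(ltW b_gt0)//= ler_pdivrMr// mul1r.
rewrite (funext gE) Rintegral_bmD; last 2 first.
- exact: bounded_measurable_cst.
- exact: bounded_measurableZ.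
rewrite Rintegral_prob_cst Rintegral_bmZ//.
have -> : expR (s * mu) + expR (s * mu) * (expR (- (s * b)) - 1) / b * mu =
    expR (s * mu) * (1 - mu / b + mu / b * expR (- (s * b))).
  by field; rewrite gt_eqF.
have -> : (s * b) ^+ 2 / 8 = s * mu + (mu / b * - (s * b) + (- (s * b)) ^+ 2 / 8).
  by field; rewrite gt_eqF.
by rewrite expRD ler_wpM2l ?expR_ge0// bernoulli_mgf_le.
Qed.

End mean_deviation.

(** * Lower tail of the sample variance *)

Section permutation_average.
Context {R : realType} {m : nat}.

(** The summand is symmetric and vanishes on the diagonal, so the ordered pairs count each unordered
    pair twice. This is the U-statistic form, ready for averaging over permutations. *)
Lemma sample_variance_double_sum (z : 'I_m -> R) :
  sample_variance z =
  1 / (m%:R * (m%:R - 1)) * \sum_(i < m) \sum_(j < m) (z i - z j) ^+ 2 / 2.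
Proof.
rewrite /sample_variance; congr (_ * _).
under eq_bigr do rewrite big_mkcond.
set S := LHS.
have S_sym : S = \sum_(i < m) \sum_(j < m)
    (if (j < i)%N then (z i - z j) ^+ 2 else 0).
  rewrite /S exchange_big; apply: eq_bigr => i _; apply: eq_bigr => j _.
  by case: ifP => // _; rewrite -sqrrN opprB.
have -> : S = (S + S) / 2 by field.
rewrite {2}S_sym -big_split mulr_suml; apply: eq_bigr => i _ /=.
rewrite -big_split mulr_suml; apply: eq_bigr => j _ /=.
by case: ltngtP => [||/val_inj ->]; rewrite ?addr0 ?add0r// subrr expr0n.
Qed.

(** A uniformly random permutation maps two distinct positions to a uniformly random ordered pair of
    distinct indices; the identity states this without division. *)
Lemma sum_perm_pair (F : 'I_m -> 'I_m -> R) (a c : 'I_m) : a != c ->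
  (forall i, F i i = 0) ->
  (m * m.-1)%:R * (\sum_(s : 'S_m) F (s a) (s c)) =
  m`!%:R * \sum_(i < m) \sum_(j < m) F i j.
Proof.
move=> ac F0; pose S i j := \sum_(s : 'S_m) F (s i) (s j).
have Sii i : S i i = 0 by rewrite /S big1.
have S_const i j : i != j -> S i j = S a c.
  (* The first transposition sends [a] to [i] and [c] to [x]; the second sends [x] to [j] and fixes
     [i]. Reindexing by [tau] thus carries the pair (a, c) to (i, j). *)
  move=> ij; pose x := tperm a i c;
    pose tau : 'S_m := (tperm a i * tperm x j)%g.
  have xi : x != i by rewrite /x -[X in _ != X](tpermL a i) (inj_eq perm_inj) eq_sym.
  have tau_a : tau a = i by rewrite permM tpermL tpermD// eq_sym.
  have tau_c : tau c = j by rewrite permM -/x tpermL.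
  rewrite /S [RHS](reindex_inj (mulgI tau)); apply: eq_bigr => s _.
  by rewrite (permM tau s a) (permM tau s c) tau_a tau_c.
have -> : m`!%:R * \sum_(i < m) \sum_(j < m) F i j = \sum_(i < m) \sum_(j < m) S i j.
  transitivity (\sum_(s : 'S_m) \sum_(i < m) \sum_(j < m) F (s i) (s j));
    last first.
    by rewrite exchange_big; apply: eq_bigr => i _; rewrite exchange_big.
  rewrite [RHS](eq_bigr (fun=> \sum_(i < m) \sum_(j < m) F i j)) => [|s _].
    by rewrite sumr_const card_Sn mulr_natl.
  rewrite [RHS](reindex_inj (@perm_inj _ s)); apply: eq_bigr => i _.
  by rewrite [RHS](reindex_inj (@perm_inj _ s)).
rewrite [RHS](eq_bigr (fun=> m.-1%:R * S a c)) => [|i _].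
  by rewrite sumr_const card_ord natrM -mulrA mulr_natl.
rewrite (bigD1 i)//= Sii add0r (eq_bigr (fun=> S a c)) => [|j ji]; last first.
  by rewrite S_const// eq_sym.
rewrite sumr_const mulr_natl; congr (_ *+ _).
by have := cardC1 i; rewrite card_ord => <-; apply: eq_card => j.
Qed.

(** The first [m./2] indices are matched with the next [m./2]; for odd [m] one index stays
    unmatched. *)
Lemma disjoint_pairs_exist : exists s : seq ('I_m * 'I_m),
  uniq (unzip1 s ++ unzip2 s) /\ size s = m./2.
Proof.
pose e := enum 'I_m; pose k := m./2.
have k2 : (k + k <= m)%N by rewrite addnn /k -[X in (_ <= X)%N](odd_double_half m) leq_addl.
have sz1 : size (take k e) = k by rewrite size_takel// size_enum_ord; lia.
have sz2 : size (take k (drop k e)) = k.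
  by rewrite size_takel// size_drop size_enum_ord; lia.
exists (zip (take k e) (take k (drop k e))).
rewrite unzip1_zip ?unzip2_zip ?sz1 ?sz2// size_zip sz1 sz2 minnn; split=> //.
by rewrite -takeD take_uniq// enum_uniq.
Qed.

End permutation_average.

(** Jensen's inequality, from the tangent of the exponential at the mean [a]. *)
Lemma expR_mean_le {R : realType} {I : finType} (f : I -> R) : (0 < #|I|)%N ->
  expR ((\sum_i f i) / #|I|%:R) <= (\sum_i expR (f i)) / #|I|%:R.
Proof.
move=> I_gt0; have I_gt0R : (0 : R) < #|I|%:R by rewrite ltr0n.
set a := (\sum_i f i) / _; rewrite ler_pdivlMr//.
have -> : expR a * #|I|%:R = \sum_i expR a * (1 + (f i - a)).
  rewrite -mulr_sumr !big_split/= sumrN !sumr_const -[a *+ _]mulr_natr /a.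
  by rewrite divfK ?gt_eqF// subrr addr0.
apply: ler_sum => i _.
have -> : expR (f i) = expR a * expR (f i - a) by rewrite -expRD addrC subrK.
by rewrite ler_wpM2l ?expR_ge0// expR_ge1Dx.
Qed.

Section variance_deviation.
Context {d d' : measure_display} {Omega : measurableType d}
  {T : measurableType d'} {R : realType} {m : nat}.
Variables (P : probability Omega R) (nu : probability T R)
  (W : 'I_m -> Omega -> T).
Hypotheses (m_gt1 : (1 < m)%N) (mW : forall i, measurable_fun setT (W i))
  (indepW : mutually_independent P W)
  (lawW : forall i A, measurable A -> P (W i @^-1` A) = nu A).
Variables (h : T -> R).
Hypotheses (bh : bounded_measurable h).

Local Notation mu := (\int[nu]_x h x).
Local Notation nu2 := (nu \x nu)%E.

Lemma Rintegral_prod (f g : T -> R) : bounded_measurable f -> bounded_measurable g ->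
  bounded_measurable (fun x : T * T => f x.1 * g x.2) /\
  \int[nu2]_x (f x.1 * g x.2) = \int[nu]_x f x * \int[nu]_x g x.
Proof.
move=> bf bg.
have bfg : bounded_measurable (fun x : T * T => f x.1 * g x.2).
  apply: (bounded_measurableM (fun x : T * T => f x.1) (fun x => g x.2)).
  - split; first exact: (measurableT_comp bf.1 measurable_fst).
    by have [M fM] := bf.2; exists M => x.
  - split; first exact: (measurableT_comp bg.1 measurable_snd).
    by have [M gM] := bg.2; exists M => x.
split=> //; apply: EFin_inj; rewrite -EFin_Rintegral//.
rewrite -(integral12_prod_meas1 (bounded_measurable_integrable nu2 _ bfg)).
rewrite mulrC EFinM -(EFin_Rintegral nu f)// -integralZl//; last first.
  exact: bounded_measurable_integrable.
apply: eq_integral => x _; rewrite /fubini_F/= -EFinM mulrC -Rintegral_bmZ//.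
by rewrite EFin_Rintegral//; exact: bounded_measurableZ.
Qed.

(** The kernel of the sample variance seen as a U-statistic. *)
Let half_sqr (x : T * T) : R := (h x.1 - h x.2) ^+ 2 / 2.

Let bm_half_sqr : bounded_measurable half_sqr.
Proof.
apply: bounded_measurableM; last exact: bounded_measurable_cst.
apply: bounded_measurableX; apply: bounded_measurableB.
- have [] := Rintegral_prod h (fun=> 1) bh (bounded_measurable_cst 1).
  by under eq_fun do rewrite mulr1.
- have [] := Rintegral_prod (fun=> 1) h (bounded_measurable_cst 1) bh.
  by under eq_fun do rewrite mul1r.
Qed.

(** Centring [h] turns the cross term into the product of two zero means, and the two squares
    contribute half the variance each. *)
Lemma Rintegral_half_sqr :
  \int[nu2]_x half_sqr x = \int[nu]_x (h x - mu) ^+ 2.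
Proof.
pose f x := h x - mu.
have bf : bounded_measurable f.
  exact/bounded_measurableB/bounded_measurable_cst.
have b1 : bounded_measurable (fun _ : T => 1 : R) by exact: bounded_measurable_cst.
have bf2 : bounded_measurable (fun x => f x ^+ 2) by exact: bounded_measurableX.
have Ef : \int[nu]_x f x = 0.
  by rewrite Rintegral_bmB ?Rintegral_prob_cst ?subrr//;
    exact: bounded_measurable_cst.
have E1 : \int[nu]_x (1 : R) = 1 by exact: Rintegral_prob_cst.
have [b11 E11] := Rintegral_prod _ _ bf2 b1.
have [b12 E12] := Rintegral_prod _ _ b1 bf2.
have [b13 E13] := Rintegral_prod _ _ bf bf.
have -> : half_sqr = (fun x => (2^-1 * (f x.1 ^+ 2 * 1) + 2^-1 * (1 * f x.2 ^+ 2))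
    - f x.1 * f x.2).
  by apply/funext => x; rewrite /half_sqr /f; field.
rewrite Rintegral_bmB//; last first.
  by apply: bounded_measurableD; exact: bounded_measurableZ.
rewrite Rintegral_bmD; [|exact: bounded_measurableZ..].
by rewrite (Rintegral_bmZ nu2 _ _ b11) (Rintegral_bmZ nu2 _ _ b12) E11 E12 E13 Ef E1; field.
Qed.

(** With k = floor(m/2), Jensen's inequality bounds exp(- k r V) by an average over permutations of
    products of [psi] along k disjoint pairs. Each product has independent factors and integrates to
    a k-th power. *)
Lemma chernoff_variance (r K y : R) : 0 <= r ->
  \int[nu2]_x expR (- (r * half_sqr x)) <= expR K ->
  (P [set w | (sample_variance (fun i => h (W i w)) < y)%R] <=
    (expR (m./2%:R * (r * y + K)))%:E)%E.
Proof.
move=> r_ge0 mgf.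
pose psi (x : T * T) := expR (- (r * half_sqr x)).
have bpsi : bounded_measurable psi.
  apply: bounded_measurable_expR; rewrite /psi.
  under eq_fun do rewrite -mulNr; exact: bounded_measurableZ.
have [s [s_uniq s_size]] := @disjoint_pairs_exist m.
pose k := m./2.
pose N : R := #|'S_m|%:R.
have Sm_gt0 : (0 < #|'S_m|)%N by rewrite card_Sn fact_gt0.
have N_gt0 : 0 < N by rewrite ltr0n.
have mpsi i j : measurable_fun setT (fun w => psi (W i w, W j w)).
  apply: (measurableT_comp bpsi.1); exact: measurable_fun_pair.
have mprod (p : 'S_m) : measurable_fun setT
    (fun w => \prod_(x <- s) psi (W (p x.1) w, W (p x.2) w)).
  exact: measurable_prod.
have prod_ge0 (p : 'S_m) w : 0 <= \prod_(x <- s) psi (W (p x.1) w, W (p x.2) w).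
  by apply: prodr_ge0 => i _; exact: expR_ge0.
have int_prod (p : 'S_m) :
    (\int[P]_w (\prod_(x <- s) psi (W (p x.1) w, W (p x.2) w))%:E =
     ((\int[nu2]_x psi x) ^+ k)%:E)%E.
  (* A permutation is injective, so the permuted pairs are still disjoint. *)
  pose ps := [seq (p x.1, p x.2) | x <- s].
  have := integral_prod_indep_pairs P nu W mW indepW lawW psi
    (\int[nu2]_x psi x) ps bpsi.1 (fun x => expR_ge0 _) (EFin_Rintegral nu2 _ bpsi)
    [::] (fun _ _ => 1) (fun=> 1).
  rewrite big_nil mulr1 /ps size_map s_size => <-.
  - by apply: eq_integral => w _; rewrite mulr1 big_map.
  - rewrite cats0 /unzip1 /unzip2 -!map_comp.
    rewrite (map_comp p fst) (map_comp p snd) -map_cat map_inj_uniq//.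
    exact: perm_inj.
  - by move=> _.
  - by move=> _ _.
  - by move=> _; rewrite EFin_Rintegral ?Rintegral_prob_cst//;
      exact: bounded_measurable_cst.
apply: (probability_le_integral _ _
    (fun w => expR (k%:R * r * y) / N *
      \sum_(p : 'S_m) \prod_(x <- s) psi (W (p x.1) w, W (p x.2) w))).
- by apply: measurable_set_lt => //; exact: measurable_sample_variance.
- by apply: measurable_funM => //; exact: measurable_sum.
- by move=> w; rewrite mulr_ge0 ?divr_ge0 ?expR_ge0 ?ler0n// sumr_ge0.
- move=> w /= V_lt; set V := sample_variance _ in V_lt.
  have avg : (\sum_(p : 'S_m) - (r * \sum_(x <- s) half_sqr (W (p x.1) w, W (p x.2) w))) / N
      = - (k%:R * r * V).
    rewrite sumrN -mulr_sumr exchange_big/=.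
    (* Each pair of [s] separately averages to the sample variance over all permutations. *)
    have pairE (x : 'I_m * 'I_m) : x \in s ->
        \sum_(p : 'S_m) half_sqr (W (p x.1) w, W (p x.2) w) = N * V.
      move=> xs; have x12 : x.1 != x.2.
        move: s_uniq; rewrite cat_uniq => /and3P[_ /hasPn dis _].
        apply/eqP => x12; have := dis x.2 (map_f snd xs).
        by rewrite -x12 (map_f fst xs).
      have := sum_perm_pair (fun i j => half_sqr (W i w, W j w)) _ _ x12.
      rewrite /half_sqr/= => E; rewrite /V sample_variance_double_sum.
      have m_neq0 : (m%:R : R) != 0 by rewrite pnatr_eq0; lia.
      have m1E : (m.-1%:R : R) = m%:R - 1.
        by rewrite -subn1 natrB//; lia.
      have m1_neq0 : (m%:R : R) - 1 != 0 by rewrite -m1E pnatr_eq0; lia.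
      apply: (mulfI (mulf_neq0 m_neq0 m1_neq0)).
      rewrite -{1}m1E -natrM E => [|i]; last by rewrite subrr expr0n mul0r.
      by rewrite /N card_Sn; field; rewrite m_neq0 m1_neq0.
    rewrite big_seq (eq_bigr _ pairE) -big_seq big_const_seq count_predT s_size.
    by rewrite iter_addr_0 -mulr_natr; field; rewrite gt_eqF.
  apply: (@le_trans _ _ (expR (k%:R * r * y) * expR (- (k%:R * r * V)))).
    rewrite -expRD -[leLHS]expR0 ler_expR -mulrBr.
    by rewrite mulr_ge0 ?mulr_ge0 ?ler0n// subr_ge0 ltW.
  rewrite -avg -[leRHS]mulrA ler_wpM2l ?expR_ge0// [leRHS]mulrC.
  apply: (le_trans (expR_mean_le _ Sm_gt0)).
  rewrite ler_wpM2r ?invr_ge0 ?ler0n//; apply: ler_sum => p _.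
  rewrite mulr_sumr -sumrN expR_sum le_eqVlt; apply/orP; left; apply/eqP.
  by apply: eq_bigr.
- under eq_integral do rewrite EFinM.
  rewrite ge0_integralZl//; last 3 first.
  + by apply/measurable_EFinP; exact: measurable_sum.
  + by move=> w _; rewrite lee_fin sumr_ge0.
  + by rewrite lee_fin divr_ge0 ?expR_ge0 ?ler0n.
  under eq_integral do rewrite -sumEFin.
  rewrite ge0_integral_sum//; last 2 first.
  + by move=> p; exact/measurable_EFinP.
  + by move=> p w _; rewrite lee_fin.
  rewrite (eq_bigr _ (fun p _ => int_prod p)) sumEFin -EFinM lee_fin.
  have -> : \sum_(p : 'S_m) (\int[nu2]_x psi x) ^+ k = N * (\int[nu2]_x psi x) ^+ k.
    by rewrite sumr_const mulr_natl.
  rewrite mulrA divfK ?gt_eqF//.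
  rewrite mulrDr expRD mulrA ler_pM2l ?expR_gt0// expRM_natl.
  by rewrite lerXn2r ?nnegrE ?expR_ge0//; apply: Rintegral_ge0 => x _;
    exact: expR_ge0.
Qed.

(** Since [half_sqr] lies in [0, b^2 / 2] and has mean v, its second moment is at most b^2 v / 2;
    the log-Laplace transform is then at most - r v + (r b u)^2 / 4. *)
Lemma variance_lower_tail (b u L : R) : (forall x, 0 <= h x <= b) -> 0 < b ->
  0 < u -> \int[nu]_x (h x - mu) ^+ 2 <= u ^+ 2 -> 0 < L ->
  (P [set w | (sample_variance (fun i => h (W i w)) <
      \int[nu]_x (h x - mu) ^+ 2 - u * b * Num.sqrt (2 * L / (m%:R - 1)))%R] <=
    (expR (- L))%:E)%E.
Proof.
move=> h0b b_gt0 u_gt0; set v := \int[nu]_x _ => v_le L_gt0.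
have m1_gt0 : (0 : R) < m%:R - 1 by rewrite subr_gt0 ltr1n.
set c := Num.sqrt _.
have c2 : c ^+ 2 = 2 * L / (m%:R - 1).
  by rewrite sqr_sqrtr// ltW// divr_gt0// mulr_gt0.
have c_ge0 : 0 <= c by exact: sqrtr_ge0.
(* The minimizer of - r u b c + (r b u)^2 / 4, with minimum - c^2. *)
pose r := 2 * c / (b * u).
have r_ge0 : 0 <= r by rewrite divr_ge0 ?mulr_ge0// ltW.
have v_ge0 : 0 <= v by apply: Rintegral_ge0 => x _; exact: sqr_ge0.
apply: (@le_trans _ _ (expR (m./2%:R *
    (r * (v - u * b * c) + (- (r * v) + (r * b * u) ^+ 2 / 4))))%:E); last first.
  rewrite lee_fin ler_expR.
  have -> : r * (v - u * b * c) + (- (r * v) + (r * b * u) ^+ 2 / 4) = - c ^+ 2.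
    by rewrite /r; field; rewrite !gt_eqF.
  (* Since c^2 = 2 L / (m - 1), this makes floor(m/2) c^2 at least L. *)
  have k_ge : m%:R - 1 <= 2 * m./2%:R :> R.
    rewrite lerBlDr -natrM natr1 ler_nat.
    by have := odd_double_half m; lia.
  rewrite mulrN lerN2 c2 mulrA ler_pdivlMr//.
  by have := ler_wpM2l (ltW L_gt0) k_ge; lra.
apply: chernoff_variance => //.
(* Bounding one factor of the squared kernel by b^2 / 2 makes the quadratic bound linear, with slope
   - [K]. *)
pose K := r - r ^+ 2 * b ^+ 2 / 4.
apply: (@le_trans _ _ (\int[nu2]_x (1 - K * half_sqr x))).
  apply: Rintegral_bm_le.
  - apply: bounded_measurable_expR; under eq_fun do rewrite -mulNr.
    exact: bounded_measurableZ.
  - exact/bounded_measurableB/bounded_measurableZ/bm_half_sqr/bounded_measurable_cst.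
  - move=> x; have /andP[h1 h1b] := h0b x.1; have /andP[h2 h2b] := h0b x.2.
    have g_ge0 : 0 <= half_sqr x by rewrite divr_ge0// sqr_ge0.
    have g_le : half_sqr x <= b ^+ 2 / 2.
      have : 0 <= (b - (h x.1 - h x.2)) * (b + (h x.1 - h x.2)).
        by apply: mulr_ge0; lra.
      by rewrite /half_sqr; lra.
    apply: (le_trans (expRN_le_quadratic _ (mulr_ge0 r_ge0 g_ge0))).
    have := ler_wpM2l (mulr_ge0 (sqr_ge0 r) g_ge0) g_le; rewrite /K; lra.
rewrite Rintegral_bmB; last 2 first.
- exact: bounded_measurable_cst.
- exact: bounded_measurableZ.
rewrite Rintegral_prob_cst Rintegral_bmZ// Rintegral_half_sqr -/v.
apply: le_trans (expR_ge1Dx _); rewrite lerD2l /K.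
have := ler_wpM2l (mulr_ge0 (sqr_ge0 r) (sqr_ge0 b)) v_le.
by rewrite !exprMn; lra.
Qed.

End variance_deviation.

(** * The empirical Bernstein bound *)

Section empirical_bernstein.
Context {d d' : measure_display} {Omega : measurableType d}
  {T : measurableType d'} {R : realType} {m : nat}.
Variables (P : probability Omega R) (nu : probability T R)
  (W : 'I_m -> Omega -> T).
Hypotheses (m_gt1 : (1 < m)%N) (mW : forall i, measurable_fun setT (W i))
  (indepW : mutually_independent P W)
  (lawW : forall i A, measurable A -> P (W i @^-1` A) = nu A).

(** Outside two events of probability at most e^(-L) each, Bernstein's inequality holds and the
    unknown standard deviation exceeds the empirical one by at most b c. *)
Lemma empirical_bernstein (h : T -> R) (b L : R) : measurable_fun setT h ->
  (forall x, 0 <= h x <= b) -> 0 < b -> 0 < L ->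
  (P [set w | (Num.sqrt (2 * sample_variance (fun i => h (W i w)) * L / m%:R) +
               7 * b * L / (3 * (m%:R - 1)) <
               \int[nu]_x h x - sample_mean (fun i => h (W i w)))%R] <=
    (2 * expR (- L))%:E)%E.
Proof.
move=> mh h0b b_gt0 L_gt0; pose Z w i := h (W i w).
have bh := bounded_measurable_itv _ _ _ mh h0b.
have m_gt0 : (0 < m)%N by exact: ltnW.
have m_gt0R : (0 : R) < m%:R by rewrite ltr0n.
have m1_gt0 : (0 : R) < m%:R - 1 by rewrite subr_gt0 ltr1n.
set mu := \int[nu]_x h x; pose v := \int[nu]_x (h x - mu) ^+ 2.
have v_ge0 : 0 <= v by apply: Rintegral_ge0 => x _; exact: sqr_ge0.
pose c := Num.sqrt (2 * L / (m%:R - 1)).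
have c_gt0 : 0 < c by rewrite sqrtr_gt0 divr_gt0// mulr_gt0.
have c2 : c ^+ 2 = 2 * L / (m%:R - 1).
  by rewrite sqr_sqrtr// ltW// divr_gt0// mulr_gt0.
(* Replacing the standard deviation by this larger [u] rules out the degenerate
   case of variance 0, at no cost since [b * c] is within the error term. *)
pose u := Num.max (Num.sqrt v) (b * c).
have u_gt0 : 0 < u by rewrite lt_max mulr_gt0// orbT.
have v_le : v <= u ^+ 2.
  by rewrite -[leLHS]sqr_sqrtr// lerXn2r ?nnegrE ?sqrtr_ge0 ?(ltW u_gt0)// le_max lexx.
have v2_gt0 : 0 < u ^+ 2 by rewrite exprn_gt0.
have bernstein := bernstein_mean P nu W m_gt0 mW indepW lawW h bh b _ L h0b b_gt0
  v2_gt0 v_le L_gt0.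
have variance := variance_lower_tail P nu W m_gt1 mW indepW lawW h bh b _ L h0b b_gt0
  u_gt0 v_le L_gt0.
rewrite -/mu -/v -/c in bernstein variance.
have mmean : measurable_fun setT (fun w => sample_mean (Z w)).
  exact: measurable_sample_mean.
have mvar : measurable_fun setT (fun w => sample_variance (Z w)).
  exact: measurable_sample_variance.
have msqrt : measurable_fun setT (@Num.sqrt R).
  apply: continuous_measurable_fun; exact: sqrt_continuous.
apply: (@le_trans _ _ (P ([set w | Num.sqrt (2 * u ^+ 2 * L / m%:R) +
      b * L / (3 * m%:R) < mu - sample_mean (Z w)] `|`
    [set w | sample_variance (Z w) < v - u * b * c]))); last first.
  apply: (le_trans (measureU2 _ _ _)).
  - by apply: measurable_set_lt => //; exact: measurable_funB.
  - exact: measurable_set_lt.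
  - rewrite (_ : 2 * expR (- L) = expR (- L) + expR (- L)); last by ring.
    by rewrite EFinD leeD.
apply: le_measure; rewrite ?inE.
- apply: measurable_set_lt; last exact: measurable_funB.
  apply: measurable_funD => //; apply: measurableT_comp => //.
  by do 2 apply: measurable_funM => //; exact: measurable_funM.
- apply: measurableU; first by apply: measurable_set_lt => //;
    exact: measurable_funB.
  exact: measurable_set_lt.
move=> w /= dev; have [V_lt|V_ge] := ltP (sample_variance (Z w)) (v - u * b * c).
  by right.
left; apply: le_lt_trans dev; set V := sample_variance (Z w) in V_ge *.
have V_ge0 : 0 <= V.
  rewrite /V /sample_variance; apply: mulr_ge0.
    by rewrite divr_ge0// mulr_ge0 ?ler0n// ltW.
  by apply: sumr_ge0 => i _; apply: sumr_ge0 => j _; exact: sqr_ge0.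
have sV_ge0 : 0 <= Num.sqrt V by exact: sqrtr_ge0.
have u_le : u <= Num.sqrt V + b * c.
  (* Otherwise sqrt v > sqrt V + b c, so u = sqrt v, and V >= sqrt v (sqrt v - b c) > sqrt v sqrt V
     >= V, a contradiction. *)
  rewrite ge_max lerDr sV_ge0 andbT leNgt; apply/negP => lt_v.
  have uE : u = Num.sqrt v by apply/max_idPl; lra.
  have := sqr_sqrtr V_ge0; have := sqr_sqrtr v_ge0; move: V_ge lt_v sV_ge0.
  rewrite uE; set sv := Num.sqrt v;
    set sV := Num.sqrt V => V_ge lt_v sV_ge0 svE sVE.
  have bc_gt0 := mulr_gt0 b_gt0 c_gt0.
  have : sV * (sV + b * c) < sv * (sv - b * c) + b * c * sV.
    nra.
  nra.
pose k := Num.sqrt (2 * L / m%:R).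
have k_ge0 : 0 <= k by exact: sqrtr_ge0.
have k_le : k <= c.
  rewrite ler_sqrt ?divr_ge0 ?mulr_ge0 ?(ltW L_gt0) ?(ltW m1_gt0)//.
  by rewrite ler_wpM2l ?mulr_ge0 ?(ltW L_gt0)// lef_pV2 ?posrE//; lra.
have -> : Num.sqrt (2 * u ^+ 2 * L / m%:R) = u * k.
  rewrite (_ : 2 * u ^+ 2 * L / m%:R = u ^+ 2 * (2 * L / m%:R)); last by ring.
  by rewrite sqrtrM ?sqr_ge0// sqrtr_sqr gtr0_norm.
have -> : Num.sqrt (2 * V * L / m%:R) = Num.sqrt V * k.
  rewrite (_ : 2 * V * L / m%:R = V * (2 * L / m%:R)); last by ring.
  by rewrite sqrtrM.
(* Origin of 7/3: b c^2 = 2 b L / (m - 1) pays for estimating the deviation, and the remaining 1/3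
   covers Bernstein's linear term. *)
have -> : 7 * b * L / (3 * (m%:R - 1)) = b * (c * c) + b * L / (3 * (m%:R - 1)).
  by rewrite -expr2 c2; field; rewrite gt_eqF.
rewrite addrA lerD//; last first.
  by rewrite ler_wpM2l ?mulr_ge0 ?(ltW L_gt0) ?(ltW b_gt0)// lef_pV2 ?posrE//;
    lra.
apply: (le_trans (ler_wpM2r k_ge0 u_le)); rewrite mulrDl lerD2l -mulrA.
by rewrite !ler_wpM2l// ltW.
Qed.

End empirical_bernstein.

(** * Logged data *)

(** Rectangles are stable under intersection and generate the product sigma-algebra. *)
Lemma probability_eq_rectangles {d1 d2 : measure_display} {T1 : measurableType d1}
    {T2 : measurableType d2} {R : realType} (p1 p2 : probability (T1 * T2)%type R) :
  (forall A B, measurable A -> measurable B -> p1 (A `*` B) = p2 (A `*` B)) ->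
  forall C, measurable C -> p1 C = p2 C.
Proof.
move=> p12 C mC.
apply: (measure_unique [set A `*` B | A in measurable & B in measurable]
  (fun=> setT)) => //.
- exact: measurable_prod_measurableType.
- move=> _ _ [A1 mA1 [B1 mB1 <-]] [A2 mA2 [B2 mB2 <-]].
  rewrite -setXI; exists (A1 `&` A2); first exact: measurableI.
  by exists (B1 `&` B2); first exact: measurableI.
- by move=> _; exists setT => //; exists setT => //; rewrite setXTT.
- by rewrite bigcup_const//; exists 0%N.
- by move=> _ [A mA [B mB <-]]; exact: p12.
- by move=> _; rewrite (@le_lt_trans _ _ 1%E) ?probability_le1 ?ltry.
Qed.

Lemma exists_law {d d' : measure_display} {Omega : measurableType d}
    {T : measurableType d'} {R : realType} (P : probability Omega R) (X : Omega -> T) :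
  measurable_fun setT X ->
  exists nu : probability T R, forall A, nu A = P (X @^-1` A).
Proof.
move=> mX; pose X' : {mfun Omega >-> T} := mfun_Sub (mem_set mX).
by exists (distribution P X').
Qed.

(** The index takes finitely many values, so the function is a finite sum cut out by its level sets.
    This handles the item at a given rank, which varies with the query. *)
Lemma measurable_fun_select {d : measure_display} {T : measurableType d}
    {R : realType} {n : nat} (s : T -> 'I_n) (F : 'I_n -> T -> R) :
  (forall i, measurable [set x | s x = i]) ->
  (forall i, measurable_fun setT (F i)) ->
  measurable_fun setT (fun x => F (s x) x).
Proof.
move=> ms mF.
rewrite (_ : (fun _ => _) = (fun x => \sum_(i < n) \1_[set x | s x = i] x * F i x)).
  by apply: measurable_sum => i; apply: measurable_funM => //;
    exact: measurable_indic.
apply/funext => x; rewrite (bigD1 (s x))//= indicE mem_set// mul1r.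
rewrite big1 ?addr0// => i /eqP si; rewrite indicE memNset ?mul0r//=.
by move=> e; exact: si.
Qed.

Lemma measurable_tnth_eq {d : measure_display} {T : measurableType d} {n : nat}
    (v : T -> n.-tuple bool) (i : 'I_n) (b : bool) : measurable_fun setT v ->
  measurable [set x | tnth (v x) i = b].
Proof.
move=> mv; have mvi := measurableT_comp (measurable_tnth i) mv.
by rewrite -[X in measurable X]setTI; exact: (mvi measurableT [set b]).
Qed.

Lemma measurable_natr_tnth {d : measure_display} {T : measurableType d}
    {R : realType} {n : nat} (v : T -> n.-tuple bool) (i : 'I_n) :
  measurable_fun setT v -> measurable_fun setT (fun x => (tnth (v x) i)%:R : R).
Proof.
move=> mv.
rewrite (_ : (fun _ => _) = \1_[set x | tnth (v x) i = true]).
  exact/measurable_indic/measurable_tnth_eq.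
apply/funext => x; rewrite indicE; congr (nat_of_bool _)%:R.
by apply/idP/idP; rewrite inE.
Qed.

(** * Propensities and clipped weights *)

Section propensity.
Context {R : realType} {d : measure_display} {Q : measurableType d} {n : nat}.
Variable PO : R.-pker (Q * n.-tuple bool)%type ~> (n.-tuple bool).
Implicit Types (x : Q * n.-tuple bool) (i : 'I_n).

Lemma measurable_observed i :
  measurable [set o : n.-tuple bool | tnth o i = true].
Proof. exact: (measurable_tnth_eq id). Qed.

Lemma EFin_propensity x i :
  (propensity PO x i)%:E = PO x [set o : n.-tuple bool | tnth o i = true].
Proof.
rewrite /propensity fineK//.
by apply: kernel_finite_transition; exact: measurable_observed.
Qed.

Lemma propensity_itv x i : 0 <= propensity PO x i <= 1.
Proof.
rewrite /propensity fine_ge0//= -lee_fin EFin_propensity -(@prob_kernel _ _ _ _ _ PO x).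
by apply: le_measure; rewrite ?inE//; exact: measurable_observed.
Qed.

Lemma measurable_propensity i : measurable_fun setT (fun x => propensity PO x i).
Proof.
rewrite /propensity; apply: measurableT_comp => //.
by apply: measurable_kernel; exact: measurable_observed.
Qed.

Lemma measurable_clipped_weight (lambda : R) i :
  measurable_fun setT (fun x => Num.min lambda (1 / propensity PO x i)).
Proof.
apply: measurable_minr => //.
(* The inverse and the power -1 agree on all nonnegative reals, 0 included. *)
rewrite (_ : (fun _ => _) = (fun x => propensity PO x i `^ (-1))).
  exact: (measurableT_comp (measurable_powR (-1)) (measurable_propensity i)).
apply/funext => x; rewrite powR_inv1 ?mul1r//.
by have /andP[] := propensity_itv x i.
Qed.

Lemma clipped_weight_itv (lambda : R) x i : 0 < lambda ->
  0 <= Num.min lambda (1 / propensity PO x i) <= lambda.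
Proof.
move=> lambda_gt0; rewrite le_min (ltW lambda_gt0) ge_min lexx orTb andbT/=.
by rewrite divr_ge0//; have /andP[] := propensity_itv x i.
Qed.

(** For p > 0 the product is min(lambda p, 1), and the maximum restores what it lacks to reach 1. *)
Lemma clipped_weight_bias (lambda : R) x i :
  0 < lambda -> 1 <= Num.min lambda (1 / propensity PO x i) * propensity PO x i +
    Num.max 0 (1 - lambda * propensity PO x i).
Proof.
move=> lambda_gt0; have /andP[p_ge0 _] := propensity_itv x i.
set p := propensity PO x i in p_ge0 *.
have [p_gt0|p_le0] := ltP 0 p; last first.
  (* At p = 0 the product vanishes and the maximum is 1. *)
  have -> : p = 0 by lra.
  by rewrite !mulr0 subr0 add0r le_max lexx orbT.
rewrite minr_pMl ?(ltW p_gt0)// divfK ?gt_eqF//.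
have [lp|lp] := leP (lambda * p) 1.
  by rewrite max_r ?subr_ge0//; lra.
by rewrite lerDl le_max lexx.
Qed.

End propensity.

(** * The common law of the log entries *)

Section logged_law.
Context {R : realType} {d : measure_display} {Q : measurableType d} {n : nat}.
Variables (PQR : probability (Q * n.-tuple bool)%type R)
  (PO : R.-pker (Q * n.-tuple bool)%type ~> (n.-tuple bool)).
Local Notation X := (Q * n.-tuple bool)%type.

(** The formula on rectangles is the same for every entry and determines the law, so the law of the
    first entry serves for all. *)
Lemma exists_logged_law {dO : measure_display} {m : nat} {Omega : measurableType dO}
    (P : probability Omega R) (W : 'I_m -> Omega -> X * n.-tuple bool) :
  (0 < m)%N -> logged_data P PQR PO W ->
  exists nu : probability (X * n.-tuple bool)%type R,
    (forall i A, measurable A -> P (W i @^-1` A) = nu A) /\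
    (forall A B, measurable A -> measurable B ->
       nu (A `*` B) = (\int[PQR]_(x in A) PO x B)%E).
Proof.
move=> m_gt0 [mW _ _ W_law];
  have [nu nuE] := exists_law P _ (mW (Ordinal m_gt0)).
exists nu; split=> [i A mA|A B mA mB];
  last by rewrite nuE -(W_law (Ordinal m_gt0)).
have [nui nuiE] := exists_law P _ (mW i).
rewrite -nuiE; apply: probability_eq_rectangles => // B C mB mC.
rewrite nuiE nuE; transitivity (\int[PQR]_(x in B) PO x C)%E.
  by rewrite -(W_law i).
by rewrite -(W_law (Ordinal m_gt0)).
Qed.

Variable nu : probability (X * n.-tuple bool)%type R.
Hypothesis nuE : forall A B, measurable A -> measurable B ->
  nu (A `*` B) = (\int[PQR]_(x in A) PO x B)%E.

(** The kernel has total mass 1, so the first marginal of [nu] is [PQR]. *)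
Lemma integral_request (phi : X -> R) : measurable_fun setT phi ->
  (forall x, 0 <= phi x) ->
  (\int[nu]_y (phi y.1)%:E = \int[PQR]_x (phi x)%:E)%E.
Proof.
move=> mphi phi_ge0.
rewrite (ge0_integral_density PQR nu fst (fun=> 1) _ _ _ _ phi)//.
  by under [RHS]eq_integral do rewrite mulr1.
move=> C mC; transitivity (nu (C `*` setT)).
  rewrite nuE// -[LHS]mul1e -integral_cst//.
  by apply: eq_integral => x _; rewrite prob_kernel.
rewrite -[X in nu X]setIT -integral_indic//; last exact: measurableX.
apply: eq_integral => y _; rewrite mulr1 !indicE; congr (nat_of_bool _)%:R%:E.
by apply/idP/idP; rewrite !inE/=; [case|split].
Qed.

(** The propensity is the conditional mean of the observation: [PQR] weighted by it is the image
    under [fst] of [nu] weighted by the observation. *)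
Lemma integral_request_observed (phi : X -> R) (i : 'I_n) :
  measurable_fun setT phi -> (forall x, 0 <= phi x) ->
  (\int[nu]_y (phi y.1 * (tnth y.2 i)%:R)%:E =
   \int[PQR]_x (phi x * propensity PO x i)%:E)%E.
Proof.
move=> mphi phi_ge0.
have mp := measurable_propensity PO i.
have p_ge0 x : 0 <= propensity PO x i by have /andP[] := propensity_itv PO x i.
have mO := @measurable_observed n i.
rewrite -(ge0_integral_density (weighted PQR _ mp p_ge0) PQR id _ _ mp p_ge0 _ phi)//.
  apply/esym; apply: ge0_integral_density => //.
  - exact: measurable_natr_tnth.
  move=> C mC; transitivity (nu (C `*` [set o : n.-tuple bool | tnth o i = true])).
    by rewrite nuE//; apply: eq_integral => x _; rewrite EFin_propensity.
  rewrite -[X in nu X]setIT -integral_indic//; last exact: measurableX.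
  apply: eq_integral => y _; rewrite !indicE -natrM mulnb;
    congr (nat_of_bool _)%:R%:E.
  by apply/idP/andP; rewrite !inE.
by move=> C _; exact: weightedE.
Qed.

(** The item [s x] is fixed by the request, so on each level set of [s] the observation can be
    replaced by its conditional mean, the propensity. *)
Lemma integral_clipped_feedback (lambda : R) (s : X -> 'I_n) : 0 < lambda ->
  (forall i, measurable [set x | s x = i]) ->
  (\int[nu]_y (Num.min lambda (1 / propensity PO y.1 (s y.1)) *
              feedback R y.2 y.1.2 (s y.1))%:E =
   \int[PQR]_x (Num.min lambda (1 / propensity PO x (s x)) *
               propensity PO x (s x) * (tnth x.2 (s x))%:R)%:E)%E.
Proof.
move=> lambda_gt0 ms.
pose phi i (x : X) : R := \1_[set x | s x = i] x *
  (Num.min lambda (1 / propensity PO x i) * (tnth x.2 i)%:R).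
have mphi i : measurable_fun setT (phi i).
  apply: measurable_funM; first exact: measurable_indic.
  apply: measurable_funM; first exact: measurable_clipped_weight.
  exact: (measurable_natr_tnth snd).
have w_ge0 x i : 0 <= Num.min lambda (1 / propensity PO x i).
  by have /andP[] := clipped_weight_itv PO lambda x i lambda_gt0.
have phi_ge0 i x : 0 <= phi i x by rewrite !mulr_ge0.
have p_ge0 x i : 0 <= propensity PO x i by have /andP[] := propensity_itv PO x i.
have select x (F : 'I_n -> R) : \sum_(i < n) phi i x * F i =
    Num.min lambda (1 / propensity PO x (s x)) * (tnth x.2 (s x))%:R * F (s x).
  rewrite (bigD1 (s x))//= big1 ?addr0; last first.
    move=> i /eqP si; rewrite /phi indicE memNset ?mul0r//= => e; exact: si.
  by rewrite /phi indicE mem_set//; congr (_ * _); exact: mul1r.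
transitivity (\int[nu]_y (\sum_(i < n) phi i y.1 * (tnth y.2 i)%:R)%:E)%E.
  apply: eq_integral => y _; congr EFin; rewrite select /feedback.
  by rewrite -!mulrA [(tnth y.2 _)%:R * _]mulrC.
under eq_integral do rewrite -sumEFin.
rewrite ge0_integral_sum//; last 2 first.
- move=> i; apply/measurable_EFinP; apply: measurable_funM.
    exact: (measurableT_comp (mphi i) measurable_fst).
  exact: (measurable_natr_tnth snd).
- by move=> i y _; rewrite lee_fin mulr_ge0.
under eq_bigr do rewrite integral_request_observed//.
rewrite -ge0_integral_sum//; last 2 first.
- move=> i; apply/measurable_EFinP; apply: measurable_funM => //.
  exact: measurable_propensity.
- by move=> i x _; rewrite lee_fin mulr_ge0.
by apply: eq_integral => x _; rewrite sumEFin select mulrAC.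
Qed.

End logged_law.

(** * Utility, clipped reward and clipping bias *)

Section clipping_bias.
Context {R : realType} {d : measure_display} {Q : measurableType d} {n : nat}.
Variables (PQR : probability (Q * n.-tuple bool)%type R)
  (PO : R.-pker (Q * n.-tuple bool)%type ~> (n.-tuple bool))
  (sigma : Q -> {set 'I_n} -> nat -> 'I_n) (lambda : R) (g : {set 'I_n}) (t : nat).
Hypotheses (lambda_gt0 : 0 < lambda)
  (msigma : forall (j : 'I_t) i, measurable [set q | sigma q g j.+1 = i]).
Local Notation X := (Q * n.-tuple bool)%type.
Local Notation weight x i := (Num.min lambda (1 / propensity PO x i)).
Local Notation bias x i := (Num.max 0 (1 - lambda * propensity PO x i)).

(** A bound on the expected reward lost by clipping, given the request; its sample mean is the last
    term of [utility_upper]. *)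
Definition clipping_bias (x : X) : R :=
  \sum_(1 <= j < t.+1) bias x (sigma x.1 g j).

(** Ordinals start at 0 and positions at 1, whence the successor. *)
Let rank (j : 'I_t) (x : X) := sigma x.1 g j.+1.

Let sum_rank (V : nmodType) (F : nat -> V) :
  \sum_(1 <= j < t.+1) F j = \sum_(j < t) F j.+1.
Proof. by rewrite big_add1 big_mkord. Qed.

Let mrank (j : 'I_t) i : measurable [set x | rank j x = i].
Proof.
rewrite -[X in measurable X]setTI.
exact: (@measurable_fst _ _ Q (n.-tuple bool) measurableT _ (msigma j i)).
Qed.

Let bm_select (F : X -> 'I_n -> R) (b : R) (j : 'I_t) :
  (forall i, measurable_fun setT (F ^~ i)) -> (forall x i, 0 <= F x i <= b) ->
  bounded_measurable (fun x => F x (rank j x)).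
Proof.
move=> mF F_itv.
apply: (bounded_measurable_itv _ 0 b) => [|x]; last exact: F_itv.
exact: (measurable_fun_select (rank j) (fun i x => F x i)).
Qed.

Let bias_itv x i : 0 <= bias x i <= 1.
Proof.
have /andP[p_ge0 _] := propensity_itv PO x i.
rewrite le_max lexx/= ge_max ler01/= lerBlDr lerDl mulr_ge0//.
exact: ltW.
Qed.

Let mbias i : measurable_fun setT (fun x => bias x i).
Proof.
apply: measurable_maxr => //; apply: measurable_funB => //.
by apply: measurable_funM => //; exact: measurable_propensity.
Qed.

Let bm_bias (j : 'I_t) : bounded_measurable (fun x => bias x (rank j x)).
Proof. exact: (bm_select _ 1 _ mbias bias_itv). Qed.

Lemma clipping_bias_itv x : 0 <= clipping_bias x <= t%:R.
Proof.
rewrite /clipping_bias sum_rank sumr_ge0 => [|j _]; last first.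
  by have /andP[] := bias_itv x (rank j x).
rewrite -[t in t%:R]card_ord -sumr_const ler_sum// => j _.
by have /andP[] := bias_itv x (rank j x).
Qed.

Lemma measurable_clipping_bias : measurable_fun setT clipping_bias.
Proof.
rewrite /clipping_bias; under eq_fun do rewrite sum_rank.
by apply: measurable_sum => j; exact: (bm_bias j).1.
Qed.

Let term (j : 'I_t) (y : X * n.-tuple bool) : R :=
  weight y.1 (rank j y.1) * feedback R y.2 y.1.2 (rank j y.1).

Let term_itv j y : 0 <= term j y <= lambda.
Proof.
have /andP[w_ge0 w_le] := clipped_weight_itv PO lambda y.1 (rank j y.1) lambda_gt0.
have /andP[f_ge0 f_le1] : 0 <= feedback R y.2 y.1.2 (rank j y.1) <= 1.
  by rewrite /feedback -natrM mulnb ler0n lern1 leq_b1.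
by rewrite /term mulr_ge0//= (le_trans _ w_le)// ler_piMr.
Qed.

Let mterm j : measurable_fun setT (term j).
Proof.
apply: (measurable_fun_select (fun y => rank j y.1)
  (fun i y => weight y.1 i * feedback R y.2 y.1.2 i)) => i.
  rewrite -[Y in measurable Y]setTI.
  exact: (@measurable_fst _ _ X (n.-tuple bool) measurableT _ (mrank j i)).
apply: measurable_funM.
  exact: (measurableT_comp (measurable_clipped_weight PO lambda i) measurable_fst).
apply: measurable_funM; first exact: (measurable_natr_tnth snd).
apply: (measurable_natr_tnth (fun y : X * n.-tuple bool => y.1.2)).
exact: (measurableT_comp measurable_snd measurable_fst).
Qed.

Lemma clipped_rewardE y :
  clipped_reward PO sigma lambda g t y = \sum_(j < t) term j y.
Proof. by rewrite /clipped_reward sum_rank. Qed.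

Lemma clipped_reward_itv y :
  0 <= clipped_reward PO sigma lambda g t y <= t%:R * lambda.
Proof.
rewrite clipped_rewardE sumr_ge0 => [|j _];
  last by have /andP[] := term_itv j y.
rewrite -[t in t%:R]card_ord mulr_natl -sumr_const ler_sum// => j _.
by have /andP[] := term_itv j y.
Qed.

Lemma measurable_clipped_reward :
  measurable_fun setT (clipped_reward PO sigma lambda g t).
Proof. by rewrite (funext clipped_rewardE); exact: measurable_sum. Qed.

(** After the observations are integrated out, the claim is compared position by position, pointwise
    in the request. *)
Lemma utility_le (nu : probability (X * n.-tuple bool)%type R) :
  (forall A B, measurable A -> measurable B ->
    nu (A `*` B) = (\int[PQR]_(x in A) PO x B)%E) ->
  (utility PQR sigma g t <=
    (\int[nu]_y clipped_reward PO sigma lambda g t y +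
     \int[nu]_y clipping_bias y.1)%:E)%E.
Proof.
move=> nuE.
have r_itv (x : X) i : 0 <= ((tnth x.2 i)%:R : R) <= 1.
  by rewrite ler0n lern1 leq_b1.
have mr i : measurable_fun setT (fun x : X => (tnth x.2 i)%:R : R).
  exact: (measurable_natr_tnth snd).
have br j := bm_select (fun x i => (tnth x.2 i)%:R) 1 j mr r_itv.
have bwpr (j : 'I_t) : bounded_measurable (fun x => weight x (rank j x) *
    propensity PO x (rank j x) * (tnth x.2 (rank j x))%:R).
  apply: bounded_measurableM => //; apply: bounded_measurableM.
  - apply: (bm_select (fun x i => weight x i) lambda).
      by move=> i; exact: measurable_clipped_weight.
    by move=> x i; exact: clipped_weight_itv.
  - apply: (bm_select (fun x i => propensity PO x i) 1).
      by move=> i; exact: measurable_propensity.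
    by move=> x i; exact: propensity_itv.
have bterm j : bounded_measurable (term j).
  exact: bounded_measurable_itv (mterm j) (term_itv j).
have -> : \int[nu]_y clipped_reward PO sigma lambda g t y = \sum_(j < t)
    \int[PQR]_x (weight x (rank j x) * propensity PO x (rank j x) *
      (tnth x.2 (rank j x))%:R).
  rewrite (funext clipped_rewardE) Rintegral_bm_sum//; apply: eq_bigr => j _.
  by rewrite /Rintegral (integral_clipped_feedback PQR PO nu nuE _ (rank j)).
have -> : \int[nu]_y clipping_bias y.1 = \sum_(j < t) \int[PQR]_x bias x (rank j x).
  rewrite -Rintegral_bm_sum// /Rintegral.
  rewrite (integral_request PQR PO nu nuE _ measurable_clipping_bias).
    by congr fine; apply: eq_integral => x _; rewrite /clipping_bias sum_rank.
  by move=> x; have /andP[] := clipping_bias_itv x.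
rewrite /utility unlock.
under eq_integral do rewrite sum_rank.
rewrite EFin_Rintegral; last exact: (bounded_measurable_sum _ _ br).
rewrite lee_fin (Rintegral_bm_sum PQR _ _ br) -big_split ler_sum//= => j _.
rewrite -Rintegral_bmD//; apply: Rintegral_bm_le => //.
  exact: bounded_measurableD.
move=> x /=; have := clipped_weight_bias PO lambda x (rank j x) lambda_gt0.
have /andP[b_ge0 _] := bias_itv x (rank j x).
(* For a relevant item this is [clipped_weight_bias]; for an irrelevant one it is nonnegativity of
   the bias. *)
by rewrite /rank; case: (tnth _ _) => /=; rewrite ?mulr1 ?mulr0 ?add0r.
Qed.

End clipping_bias.

(** * The upper confidence bound on the utility *)

Theorem proposition4p6 (R : realType) (d dO : measure_display)
  (D : Type) (n : nat) (item : 'I_n -> D)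
  (G : {set {set 'I_n}})
  (Q : measurableType d) (PQR : probability (Q * n.-tuple bool)%type R)
  (f : Q -> D -> R) (f01 : forall q x, 0 <= f q x <= 1)
  (sigma : Q -> {set 'I_n} -> nat -> 'I_n)
  (sigma_ranking : forall q g, g \in G ->
    is_ranking (fun i => f q (item i)) g (sigma q g))
  (sigma_measurable : forall g j (i : 'I_n), g \in G -> (1 <= j <= #|g|)%N ->
    measurable [set q | sigma q g j = i])
  (tmax : {set 'I_n} -> nat)
  (tmax_bound : forall g, g \in G -> (1 <= tmax g <= #|g|)%N)
  (m : nat) (m_gt1 : (1 < m)%N)
  (PO : R.-pker (Q * n.-tuple bool)%type ~> (n.-tuple bool))
  (Omega : measurableType dO) (P : probability Omega R)
  (W : 'I_m -> Omega -> (Q * n.-tuple bool) * n.-tuple bool)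
  (W_logged : logged_data P PQR PO W)
  (positivity : exists2 gamma : R, 0 < gamma &
    forall g, g \in G -> forall (q : Q) (r : n.-tuple bool) j,
      (1 <= j <= tmax g)%N -> gamma < propensity PO (q, r) (sigma q g j))
  (lambda : R) (lambda_gt0 : 0 < lambda)
  (g : {set 'I_n}) (gG : g \in G)
  (t : nat) (t_range : (1 <= t <= tmax g - 1)%N)
  (alpha : R) (alpha01 : 0 < alpha < 1) :
  ((1 - alpha)%:E <=
    P [set w | (utility PQR sigma g t <=
      (utility_upper PO sigma lambda g t alpha (fun i => W i w))%:E)%E])%E.
Proof.
have m_gt0 : (0 < m)%N by exact: ltnW.
have /andP[alpha_gt0 alpha_lt1] := alpha01.
have msigma (j : 'I_t) i : measurable [set q | sigma q g j.+1 = i].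
  apply: sigma_measurable => //; have := tmax_bound g gG; have := ltn_ord j.
  by lia.
have [nu [lawW nuE]] := exists_logged_law PQR PO P W m_gt0 W_logged.
have [mW indepW _ _] := W_logged.
pose zeta := clipped_reward PO sigma lambda g t.
pose beta (y : (Q * n.-tuple bool) * n.-tuple bool) :=
  clipping_bias PO sigma lambda g t y.1.
have mzeta : measurable_fun setT zeta by exact: measurable_clipped_reward.
have zeta_itv y : 0 <= zeta y <= t%:R * lambda by exact: clipped_reward_itv.
have mbeta : measurable_fun setT beta.
  apply: (measurableT_comp _ measurable_fst).
  exact: measurable_clipping_bias.
have beta_itv y : 0 <= beta y <= t%:R by exact: clipping_bias_itv.
have bzeta := bounded_measurable_itv _ _ _ mzeta zeta_itv.
have bbeta := bounded_measurable_itv _ _ _ mbeta beta_itv.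
have t_gt0 : (0 : R) < t%:R by rewrite ltr0n; case/andP: t_range.
have L_gt0 (a : R) : 1 < a -> 0 < ln (a / alpha).
  by move=> a_gt1; apply: ln_gt0;
    rewrite ltr_pdivlMr// mul1r (lt_trans alpha_lt1).
have expL (a : R) : 1 < a -> expR (- ln (a / alpha)) = alpha / a.
  move=> a_gt1; have a_gt0 : 0 < a by exact: lt_trans a_gt1.
  by rewrite expRN lnK ?posrE ?divr_gt0// invf_div.
have gt1_4 : 1 < (4 : R) by rewrite ltr1n.
have gt1_2 : 1 < (2 : R) by rewrite ltr1n.
(* With L = ln(4 / alpha) the failure probability 2 e^(-L) is alpha / 2; the rewards range in
   [0, t lambda]. *)
have reward := empirical_bernstein P nu W m_gt1 mW indepW lawW zeta _ _ mzeta zeta_itv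
  (mulr_gt0 t_gt0 lambda_gt0) (L_gt0 4 gt1_4).
(* With L = ln(2 / alpha) the failure probability e^(-L) is alpha / 2; the biases range in
   [0, t]. *)
have bias := hoeffding_mean P nu W m_gt0 mW indepW lawW beta bbeta _ _ beta_itv t_gt0
  (L_gt0 2 gt1_2).
rewrite expL// in reward; rewrite expL// in bias.
set A := [set w | _]%classic.
set A1 := [set w | _] in reward; set A2 := [set w | _] in bias.
have mmean1 : measurable_fun setT (fun w => sample_mean (fun i => zeta (W i w))).
  exact: measurable_sample_mean.
have mmean2 : measurable_fun setT (fun w => sample_mean (fun i => beta (W i w))).
  exact: measurable_sample_mean.
have mvar : measurable_fun setT (fun w =>
    Num.sqrt (2 * sample_variance (fun i => zeta (W i w)) * ln (4 / alpha) / m%:R)).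
  apply: (@measurableT_comp _ _ _ _ _ _ (@Num.sqrt R)).
    apply: continuous_measurable_fun; exact: sqrt_continuous.
  do 2 apply: measurable_funM => //; apply: measurable_funM => //.
  exact: measurable_sample_variance.
have mA1 : measurable A1.
  apply: measurable_set_lt; last exact: measurable_funB.
  exact: measurable_funD.
have mA2 : measurable A2 by apply: measurable_set_lt => //;
  exact: measurable_funB.
have mA : measurable A.
  rewrite /A -[X in measurable X]setTI; apply: measurable_lee => //.
  apply/measurable_EFinP; apply: measurable_funD; last exact: mmean2.
  do 2 (apply: measurable_funD => //).
  by apply: measurable_funD; [exact: mmean1|exact: mvar].
(* When neither deviation occurs, adding the two bounds to [utility_le] gives exactly
   [utility_upper]. *)
have notA_sub : ~` A `<=` A1 `|` A2.
  move=> w; apply: contra_notP => /not_orP[/negP nA1 /negP nA2].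
  rewrite -leNgt in nA1; rewrite -leNgt in nA2.
  apply: (le_trans (utility_le PQR PO sigma lambda g t lambda_gt0 msigma nu nuE)).
  rewrite lee_fin; have := lerD nA1 nA2.
  rewrite -/zeta /utility_upper /utility_cipw -/zeta !mulrA => h.
  set Z := sample_mean (fun i => zeta (W i w)) in h *.
  rewrite -[X in _ <= _ + _ + _ + _ + X]/(sample_mean (fun i => beta (W i w))).
  rewrite -[X in _ <= X + _ + _ + _ + _]/Z.
  move: h; lra.
have PA_fin : P A \is a fin_num by exact: fin_num_measure.
have : (P (~` A) <= (alpha)%:E)%E.
  apply: (@le_trans _ _ (P (A1 `|` A2))).
    by apply: le_measure; rewrite ?inE//;
      [exact: measurableC|exact: measurableU].
  apply: (le_trans (measureU2 _ mA1 mA2)); apply: (le_trans (leeD reward bias)).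
  by rewrite -EFinD lee_fin; lra.
rewrite probability_setC// => PA.
by rewrite EFinB leeBlDr// addeC -leeBlDr.
Qed.
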